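(* For $1\le k\le n-1$, $$\mathcal{N}(d^k_h,\mathbf{W}^{\rm nc}_h\Lambda^k)\ominus^\perp\mathcal{R}(d^{k-1}_h,\mathbf{W}^{\rm nc}_h\Lambda^{k-1})=\mathcal{N}(\delta_k,\mathbf{W}^*_{h0}\Lambda^k)\ominus^\perp\mathcal{R}(\delta_{k+1},\mathbf{W}^*_{h0}\Lambda^{k+1})$$ and $$\mathcal{N}(d^k_h,\mathbf{W}^{\rm nc}_{h0}\Lambda^k)\ominus^\perp\mathcal{R}(d^{k-1}_h,\mathbf{W}^{\rm nc}_{h0}\Lambda^{k-1})=\mathcal{N}(\delta_k,\mathbf{W}^*_h\Lambda^k)\ominus^\perp\mathcal{R}(\delta_{k+1},\mathbf{W}^*_h\Lambda^{k+1}).$$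
   Context: Let $n\ge 1$, let $\Omega\subset\mathbb{R}^n$ be a bounded polyhedral domain and $\mathcal{G}_h$ a simplicial subdivision of $\Omega$. $\mathcal{N}(T,D)=\{v\in D:Tv=0\}$, $\mathcal{R}(T,D)=\{Tv:v\in D\}$; for $A\subset B\subset L^2\Lambda^k(\Omega)$, $B\ominus^\perp A$ is the $L^2$-orthogonal complement of $A$ in $B$. Forms. $d^k$ is the exterior derivative on $k$-forms, $\star$ the Hodge star, $\langle\cdot,\cdot\rangle_{L^2\Lambda^k}$ the $L^2(\Omega)$ inner product, and $\delta_k$ the codifferential on $k$-forms, i.e. the formal adjoint of $d^{k-1}$: $\langle d^{k-1}\mu,\eta\rangle_{L^2\Lambda^k}=\langle\mu,\delta_k\eta\rangle_{L^2\Lambda^{k-1}}$ whenever one of the smooth forms $\mu,\eta$ has compact support (thus $\delta_k=\pm\star d^{n-k}\star$). For $1\le k\le n$, $H^*\Lambda^k(\Omega)=\{\mu\in L^2\Lambda^k(\Omega):\delta_k\mu\in L^2\Lambda^{k-1}(\Omega)\}$ with the graph norm, and $H^*_0\Lambda^k(\Omega)$ is the closure in it of smooth compactly supported forms. Whitney forms. $\mathcal{P}_0\Lambda^k$ denotes constant-coefficient $k$-forms. The Koszul operator is $\kappa(dx^{\alpha_1}\wedge\dots\wedge dx^{\alpha_k})=\sum_{j=1}^k(-1)^{j+1}x^{\alpha_j}dx^{\alpha_1}\wedge\dots\wedge\widehat{dx^{\alpha_j}}\wedge\dots\wedge dx^{\alpha_k}$; $\mathcal{P}_1^-\Lambda^k=\mathcal{P}_0\Lambda^k+\kappa(\mathcal{P}_0\Lambda^{k+1})$,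 $\mathcal{P}_1^{*,-}\Lambda^k=\star(\mathcal{P}_1^-\Lambda^{n-k})$. $\mathcal{P}_1^-\Lambda^k(\mathcal{G}_h)$ and $\mathcal{P}_1^{*,-}\Lambda^k(\mathcal{G}_h)$ are the corresponding piecewise spaces (no inter-element continuity). $d^k_h$ is $d^k$ applied cell by cell. Spaces. $\mathbf{W}^*_h\Lambda^k=\mathcal{P}_1^{*,-}\Lambda^k(\mathcal{G}_h)\cap H^*\Lambda^k(\Omega)$, $\mathbf{W}^*_{h0}\Lambda^k=\mathcal{P}_1^{*,-}\Lambda^k(\mathcal{G}_h)\cap H^*_0\Lambda^k(\Omega)$. For $0\le k\le n-1$, $\mathbf{W}^{\rm nc}_h\Lambda^k=\{\omega_h\in\mathcal{P}_1^-\Lambda^k(\mathcal{G}_h):\langle\omega_h,\delta_{k+1}\eta_h\rangle_{L^2\Lambda^k}-\langle d^k_h\omega_h,\eta_h\rangle_{L^2\Lambda^{k+1}}=0\ \forall\,\eta_h\in\mathbf{W}^*_{h0}\Lambda^{k+1}\}$, and $\mathbf{W}^{\rm nc}_{h0}\Lambda^k$ is defined in the same way but with the condition for all $\eta_h\in\mathbf{W}^*_h\Lambda^{k+1}$. *)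

(* Defs.v *)
From HB Require Import structures.
From mathcomp Require Import all_boot all_order all_algebra.
From mathcomp Require Import all_classical all_reals all_analysis.
Set Implicit Arguments.
Unset Strict Implicit.
Unset Printing Implicit Defensive.
Import Order.TTheory GRing.Theory Num.Theory.
Import numFieldNormedType.Exports.

Local Open Scope classical_set_scope.
Local Open Scope ring_scope.

(** Borel sigma-algebra and Lebesgue measure on [R^n = 'rV[R]_n].
    The sigma-algebra is the product one, generated by the coordinates (as the
    library does for [n.-tuple]); for [R^n] this is the Borel sigma-algebra.
    The measure is the [n]-fold product of the one-dimensional
    [lebesgue_measure]; see [lebesgue_rV_box]. *)

Definition rV_display : measure_display.
Proof. exact: default_measure_display. Qed.

Section measurable_rV.
Context (R : realType) (n : nat).

Definition rV_coor (i : 'I_n) (v : 'rV[R]_n) : measurableTypeR R := v ord0 i.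

Let rV_set0 : g_sigma_preimage rV_coor set0.
Proof. exact: sigma_algebra0. Qed.

Let rV_setC A : g_sigma_preimage rV_coor A -> g_sigma_preimage rV_coor (~` A).
Proof. exact: sigma_algebraC. Qed.

Let rV_bigcup (F : (set 'rV[R]_n)^nat) :
  (forall i, g_sigma_preimage rV_coor (F i)) ->
  g_sigma_preimage rV_coor (\bigcup_i (F i)).
Proof. exact: sigma_algebra_bigcup. Qed.

HB.instance Definition _ := @isMeasurable.Build rV_display
  'rV[R]_n (g_sigma_preimage rV_coor) rV_set0 rV_setC rV_bigcup.

End measurable_rV.

Lemma measurable_rV_coor (R : realType) n (i : 'I_n) :
  measurable_fun [set: 'rV[R]_n] (rV_coor i).
Proof.
move=> _ Y mY; rewrite setTI; apply: sub_sigma_algebra => /=.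
rewrite -bigcup_seq/=; exists i => /=; first by rewrite mem_index_enum.
by exists Y => //; rewrite setTI.
Qed.

Lemma measurable_fun_rV (R : realType) d (T : measurableType d) n
    (f : T -> 'rV[R]_n) :
  (forall i, measurable_fun [set: T] (rV_coor i \o f)) ->
  measurable_fun [set: T] f.
Proof.
move=> mf.
have prefS : g_sigma_preimage (fun i => rV_coor i \o f) `<=` measurable.
  apply: smallest_sub; first exact: sigma_algebra_measurable.
  rewrite -bigcup_seq; apply: bigcup_sub => i Ii.
  by move=> A [B mB <-]; exact: mf.
rewrite g_sigma_preimage_comp in prefS.
by move=> _ A mA; apply: prefS; exists A.
Qed.

Section lebesgue_rV.
Context (R : realType).

Definition rV_cons n (p : measurableTypeR R * 'rV[R]_n) : 'rV[R]_n.+1 :=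
  \row_i oapp (p.2 ord0) p.1 (unlift ord0 i).

Definition rV_uncons n (v : 'rV[R]_n.+1) : measurableTypeR R * 'rV[R]_n :=
  (v ord0 ord0, \row_j v ord0 (lift ord0 j)).

Lemma rV_consK n : cancel (@rV_cons n) (@rV_uncons n).
Proof.
move=> [x v]; rewrite /rV_uncons /rV_cons mxE unlift_none /=; congr pair.
by apply/rowP => j; rewrite !mxE liftK.
Qed.

Lemma measurable_rV_cons n : measurable_fun setT (@rV_cons n).
Proof.
apply: measurable_fun_rV => i; rewrite /rV_coor /comp.
under eq_fun do rewrite mxE.
case: (unliftP ord0 i) => [j|] _ /=; last exact: measurable_fst.
exact: (measurableT_comp (@measurable_rV_coor R n j) measurable_snd).
Qed.

Lemma measurable_rV_uncons n : measurable_fun setT (@rV_uncons n).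
Proof.
apply/measurable_fun_pairP; split.
  exact: (@measurable_rV_coor R n.+1 ord0).
apply: measurable_fun_rV => i; rewrite /rV_coor /comp /=.
under eq_fun do rewrite mxE.
exact: (@measurable_rV_coor R n.+1 (lift ord0 i)).
Qed.

Section step.
Context n (mu : {sigma_finite_measure set 'rV[R]_n -> \bar R}).

Definition lebesgue_rV_step : set 'rV[R]_n.+1 -> \bar R :=
  pushforward (@lebesgue_measure R \x mu)%E (@rV_cons n).

Let step0 : lebesgue_rV_step set0 = 0%E.
Proof. by rewrite /lebesgue_rV_step /pushforward preimage_set0 measure0. Qed.

Let step_ge0 A : (0 <= lebesgue_rV_step A)%E.
Proof. by rewrite /lebesgue_rV_step /pushforward measure_ge0. Qed.

Let step_sigma_additive : semi_sigma_additive lebesgue_rV_step.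
Proof.
move=> F mF tF mUF; rewrite /lebesgue_rV_step /pushforward preimage_bigcup.
have mpre A : measurable A -> measurable (@rV_cons n @^-1` A).
  by move=> mA; rewrite -[X in measurable X]setTI; exact: measurable_rV_cons.
apply: measure_semi_sigma_additive.
- by move=> i; exact: mpre.
- apply/trivIsetP => /= i j _ _ ij; rewrite -preimage_setI.
  by move/trivIsetP : tF => /(_ _ _ _ _ ij) ->//; rewrite preimage_set0.
- by rewrite -preimage_bigcup; exact: mpre.
Qed.

HB.instance Definition _ := isMeasure.Build _ _ _ lebesgue_rV_step
  step0 step_ge0 step_sigma_additive.

Let step_sigma_finite : sigma_finite setT lebesgue_rV_step.
Proof.
have /sigma_finiteP[F [TF ndF Foo]] := sigma_finiteT (@lebesgue_measure R).
have /sigma_finiteP[G [TG ndG Goo]] := sigma_finiteT mu.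
exists (fun k => @rV_uncons n @^-1` (F k `*` G k)).
  rewrite -preimage_bigcup (_ : \bigcup_i (F i `*` G i) = setT) ?preimage_setT//.
  rewrite -subTset => -[x v] _.
  have : (\bigcup_i F i) x by rewrite -TF.
  have : (\bigcup_i G i) v by rewrite -TG.
  move=> [j _ Gjv] [i _ Fix]; exists (maxn i j) => //; split => /=.
  - by move: x Fix; exact/subsetPset/ndF/leq_maxl.
  - by move: v Gjv; exact/subsetPset/ndG/leq_maxr.
move=> k; have [mF Fk] := Foo k; have [mG Gk] := Goo k; split.
  rewrite -[X in measurable X]setTI.
  by apply: measurable_rV_uncons => //; exact: measurableX.
rewrite /lebesgue_rV_step /pushforward -comp_preimage.
rewrite (_ : _ \o _ = id); last by apply/funext => p /=; rewrite rV_consK.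
by rewrite preimage_id product_measure1E// lte_mul_pinfty// ge0_fin_numE.
Qed.

HB.instance Definition _ := Measure_isSigmaFinite.Build _ _ _ lebesgue_rV_step
  step_sigma_finite.

End step.

Fixpoint lebesgue_rV (n : nat) : {sigma_finite_measure set 'rV[R]_n -> \bar R} :=
  match n with
  | 0 => (\d_(0 : 'rV[R]_0) : {sigma_finite_measure set 'rV[R]_0 -> \bar R})
  | m.+1 => (lebesgue_rV_step (lebesgue_rV m)
      : {sigma_finite_measure set 'rV[R]_m.+1 -> \bar R})
  end.

End lebesgue_rV.

Lemma lebesgue_rV_box (R : realType) n (A : 'I_n -> set (measurableTypeR R)) :
  (forall i, measurable (A i)) ->
  lebesgue_rV R n [set v | forall i, A i (v ord0 i)]
  = (\prod_(i < n) lebesgue_measure (A i))%E.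
Proof.
elim: n A => [|n IH] A mA.
  rewrite big_ord0 /= diracE mem_set//.
  by move=> [].
rewrite big_ord_recl -IH//= /lebesgue_rV_step /pushforward -product_measure1E//.
  congr (_ _); apply/seteqP; split => -[x v] /=; rewrite /rV_cons.
    move=> h; split; first by have := h ord0; rewrite mxE unlift_none.
    by move=> i; have := h (lift ord0 i); rewrite mxE liftK.
  move=> [Ax Av] i; rewrite mxE.
  by case: (unliftP ord0 i) => [j|] ->//=.
have -> : (fun v : 'rV[R]_n => forall i, A (lift ord0 i) (v ord0 i)) =
    \bigcap_(i in [set: 'I_n]) (rV_coor i @^-1` A (lift ord0 i)).
  by apply/seteqP; split => v /= h i; [move=> _|]; exact: h.
apply: fin_bigcap_measurable => // i _.
by rewrite -[X in measurable X]setTI; exact: measurable_rV_coor.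
Qed.

(** Exterior algebra of [R^n].  A covector [c] is given by its coefficients
    [c I] on the basis [dx^I = dx^{i_1} /\ ... /\ dx^{i_k}],
    [I = {i_1 < ... < i_k}]; it is a [k]-covector if only the subsets [I] of
    cardinality [k] contribute. *)

Section exterior.
Context (R : realType) (n : nat).

Definition covector : Type := {ffun {set 'I_n} -> R}.

Definition kcovector (k : nat) : set covector :=
  [set c | forall I : {set 'I_n}, #|I| != k -> c I = 0].

(** [sgn_ins i I] is the sign of the permutation moving [i] to its place
    in [I]: [dx^i /\ dx^(I :\ i) = sgn_ins i I dx^I] for [i \in I], and
    [dx^i /\ dx^I = sgn_ins i I dx^(i |: I)] for [i \notin I]. *)
Definition sgn_ins (i : 'I_n) (I : {set 'I_n}) : R :=
  (-1) ^+ #|[set j in I | (j < i)%N]%SET|.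

(** [dx^I /\ dx^J = sgn_wedge I J dx^(I :|: J)] for disjoint [I] and [J]. *)
Definition sgn_wedge (I J : {set 'I_n}) : R :=
  (-1) ^+ #|[set p : 'I_n * 'I_n |
               [&& p.1 \in I, p.2 \in J & (p.2 < p.1)%N]]%SET|.

(** [hodge (dx^I) = sgn_wedge I (~: I) dx^(~: I)], so that
    [dx^I /\ hodge (dx^I)] is the volume form. *)
Definition hodge (c : covector) : covector :=
  [ffun J : {set 'I_n} => sgn_wedge (~: J) J * c (~: J)].

(** [koszul x] maps [dx^I] to the sum over [i \in I] of
    [sgn_ins i I * x^i * dx^(I :\ i)]; the coefficient on [dx^J] therefore
    comes from the [I = i |: J] with [i \notin J]. *)
Definition koszul (x : 'rV[R]_n) (c : covector) : covector :=
  [ffun J : {set 'I_n} =>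
    \sum_(i | i \notin J) sgn_ins i J * x ord0 i * c (i |: J)].

(** Differential forms are covector fields defined on all of [R^n]; only their
    values on the domain [Om] below matter, up to null sets. *)
Definition form : Type := 'rV[R]_n -> covector.

Definition kform (k : nat) : set form := [set w | forall x, kcovector k (w x)].

Definition partial (i : 'I_n) (f : 'rV[R]_n -> R) : 'rV[R]_n -> R :=
  fun x => 'D_(delta_mx ord0 i) f x.

Definition iter_partial (s : seq 'I_n) (f : 'rV[R]_n -> R) : 'rV[R]_n -> R :=
  foldr partial f s.

Definition smooth (f : 'rV[R]_n -> R) : Prop :=
  forall s : seq 'I_n, continuous (iter_partial s f) /\
    forall i x, derivable (iter_partial s f) x (delta_mx ord0 i).

(** [d (f dx^I)] is the sum over [i] of [partial i f dx^i /\ dx^I]. *)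
Definition extd (w : form) : form := fun x =>
  [ffun J : {set 'I_n} =>
    \sum_(i in J) sgn_ins i J * partial i (fun y => w y (J :\ i)) x].

Definition whitney (k : nat) : set form :=
  [set w | exists a b : covector, [/\ kcovector k a, kcovector k.+1 b &
    w = fun x => a + koszul x b]].

Definition whitney_star (k : nat) : set form :=
  [set w | exists2 v, whitney (n - k) v & w = fun x => hodge (v x)].

End exterior.

(** Simplices and subdivisions.  A simplex is given by the matrix whose [n.+1]
    rows are its vertices. *)

Section geometry.
Context (R : realType) (n : nat).
Implicit Types (V : 'M[R]_(n.+1, n)) (G : seq 'M[R]_(n.+1, n))
  (Om : set 'rV[R]_n).

Definition face V (A : {set 'I_n.+1}) : set 'rV[R]_n :=
  [set x | exists l : 'rV[R]_n.+1, [/\ forall i, 0 <= l ord0 i,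
    forall i, i \notin A -> l ord0 i = 0, \sum_i l ord0 i = 1 & x = l *m V]].

Definition cell V : set 'rV[R]_n := face V [set: 'I_n.+1]%SET.

Definition affinely_independent V : Prop :=
  forall l : 'rV[R]_n.+1, \sum_i l ord0 i = 0 -> l *m V = 0 -> l = 0.

Definition cells G : set 'rV[R]_n := [set x | exists2 V, V \in G & cell V x].

(** Bounded connected open set which is the interior of a polyhedron, i.e. of a
    finite union of nondegenerate simplices. *)
Definition polyhedral_domain Om : Prop :=
  [/\ open Om, connected Om, Om !=set0, bounded_set Om &
    exists2 P : seq 'M[R]_(n.+1, n),
      (forall V, V \in P -> affinely_independent V) & Om = interior (cells P)].

(** Any two cells meet along a common face, possibly empty ([A] and [B] empty)
    or a whole cell. *)
Definition simplicial_subdivision Om G : Prop :=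
  [/\ forall V, V \in G -> affinely_independent V,
    closure Om = cells G &
    forall V W, V \in G -> W \in G -> exists A B : {set 'I_n.+1},
      cell V `&` cell W = face V A /\ cell V `&` cell W = face W B].

End geometry.

Section spaces.
Context (R : realType) (n : nat).
Context (Om : set 'rV[R]_n) (G : seq 'M[R]_(n.+1, n)).
Implicit Types (k : nat) (w u : form R n).

Local Notation mu := (lebesgue_rV R n).

Definition L2form k : set (form R n) :=
  [set w | kform k w /\ forall I : {set 'I_n},
    measurable_fun Om (fun x => w x I) /\
    mu.-integrable Om (fun x => ((w x I) ^+ 2)%:E)].

Definition dotL2 w u : R :=
  \sum_(I : {set 'I_n}) \int[mu]_(x in Om) (w x I * u x I).

Definition normL2 w : R := Num.sqrt (dotL2 w w).

Definition test_form k : set (form R n) :=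
  [set w | [/\ kform k w, forall I : {set 'I_n}, smooth (fun x => w x I),
    compact (closure [set x | w x != 0]) & closure [set x | w x != 0] `<=` Om]].

(** Operators are given by their graphs, elements of [L2] being represented by
    functions: [T w u] reads "[T w = u] almost everywhere on [Om]". *)
Definition operator : Type := form R n -> form R n -> Prop.

Definition null_space (T : operator) (D : set (form R n)) : set (form R n) :=
  [set w | D w /\ T w (fun=> 0)].

Definition range_space (T : operator) (D : set (form R n)) : set (form R n) :=
  [set u | exists2 w, D w & T w u].

Definition ominus (B A : set (form R n)) : set (form R n) :=
  [set w | B w /\ forall u, A u -> dotL2 w u = 0].

(** The codifferential of [k]-forms, for [1 <= k], in the weak sense. *)
Definition codiff k : operator := fun w u =>
  [/\ L2form k w, L2form k.-1 u &
    forall v, test_form k.-1 v -> dotL2 (extd v) w = dotL2 v u].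

Definition Hstar k : set (form R n) := [set w | exists u, codiff k w u].

(** Closure of the test forms for the graph norm of [codiff k]. *)
Definition Hstar0 k : set (form R n) :=
  [set w | exists2 u, codiff k w u & forall e : R, 0 < e ->
    exists v z, [/\ test_form k v, codiff k v z &
      Num.sqrt (normL2 (fun x => w x - v x) ^+ 2 +
                normL2 (fun x => u x - z x) ^+ 2) < e]].

(** [w] is in [L2] and coincides on each cell with a member of [P]; nothing is
    asked across faces. *)
Definition piecewise k (P : set (form R n)) : set (form R n) :=
  [set w | L2form k w /\ forall V, V \in G ->
    exists2 p, P p & w = p %[ae mu in cell V]].

(** The exterior derivative applied cell by cell to a piecewise Whitney form. *)
Definition dh k : operator := fun w u =>
  L2form k.+1 u /\ forall V, V \in G -> exists p, [/\ whitney k p,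
    w = p %[ae mu in cell V] & u = extd p %[ae mu in cell V]].

Definition Wstar k : set (form R n) :=
  piecewise k (whitney_star (n:=n) k) `&` Hstar k.

Definition Wstar0 k : set (form R n) :=
  piecewise k (whitney_star (n:=n) k) `&` Hstar0 k.

(** [u'] is the codifferential of [u] and [w'] the cellwise exterior derivative
    of [w], both determined up to a null set. *)
Definition nonconforming k (D : set (form R n)) : set (form R n) :=
  [set w | piecewise k (whitney (n:=n) k) w /\
    forall u u' w', D u -> codiff k.+1 u u' -> dh k w w' ->
      dotL2 w u' - dotL2 w' u = 0].

Definition Wnc k : set (form R n) := nonconforming k (Wstar0 k.+1).

Definition Wnc0 k : set (form R n) := nonconforming k (Wstar k.+1).

End spaces.

(* Main.v *)
(* Fix [D0], one of the spaces [W*_{h0} Lambda^k], [W*_h Lambda^k].  Elements of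
   both sides are piecewise constant, because [d (a + koszul b)] is a nonzero
   multiple of [b], and likewise for the codifferential of its Hodge star.  For a
   piecewise constant [w], orthogonality to the range of the codifferential on
   degree [k+1] is the condition defining [W^nc Lambda^k].  So it remains to show
   that [w] lies in the kernel of the codifferential in [D0] if and only if it is
   orthogonal to [d_h (W^nc Lambda^{k-1})].
   The direct implication is the definition of [W^nc Lambda^{k-1}].  Conversely,
   the functional [mu |-> - <d_h mu, w>] on piecewise Whitney forms vanishes on
   [W^nc Lambda^{k-1}], the common kernel of the functionals
   [mu |-> <mu, delta eta> - <d_h mu, eta>] for [eta] in [D0]; by finite dimension
   it is one of these.  Testing on [mu = dx^I] and on [mu = koszul x dx^J] on a
   single cell gives [delta eta = 0] and then [eta = w].
   The weak codifferential is identified on each cell with the classical one by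
   testing against products of one-variable bump functions. *)
From mathcomp Require Import all_boot all_order all_algebra.
From mathcomp Require Import all_classical all_reals all_analysis.
From mathcomp Require Import measurable_realfun.
From mathcomp Require Import ring lra zify.
Require Import Defs.
Set Implicit Arguments.
Unset Strict Implicit.
Unset Printing Implicit Defensive.
Import Order.TTheory GRing.Theory Num.Theory.
Import numFieldNormedType.Exports.

Local Open Scope classical_set_scope.
Local Open Scope ring_scope.

(** * Exterior algebra of Whitney forms *)

(** No basis and no degrees of freedom of the nonconforming spaces are used. Such a space is seen
    only as the annihilator of the functionals coming from [D0], and linear algebra returns one of
    these functionals. Four properties of [D0] suffice for this: it consists of piecewise star
    Whitney forms, contains [0], is closed under linear combinations, and is insensitive to null
    sets. The boundary condition is visible nowhere else, so both equalities are instances of the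
    same two inclusions. The last property is forced by letting functions stand for [L2] classes:
    the form [eta] found by duality agrees with [w] only almost everywhere. Testing against
    constants on a cell gives integrals over that cell and nothing more, which fixes the order of
    the two tests. The codifferential of [eta] is constant on a cell because [eta] is affine there,
    so integral zero makes it vanish; only then is [eta] itself constant, and its integral
    identifies it with [w]. Of the geometry three facts are used: open cells lie in [Om], the cells
    cover [Om], and distinct cells overlap in a null set. *)

Section whitney_algebra.
Context (R : realType) (n : nat).
Implicit Types (i j : 'I_n) (I J K : {set 'I_n}) (a b : covector R n).

Lemma sgn_ins_sqr i I : sgn_ins R i I * sgn_ins R i I = 1.
Proof. by rewrite /sgn_ins -exprD addnn -mul2n exprM sqrrN !expr1n. Qed.

Lemma sgn_ins_U1 i I : sgn_ins R i (i |: I) = sgn_ins R i I.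
Proof.
rewrite /sgn_ins; congr (_ ^+ _); apply: eq_card => j; rewrite !inE.
by case: eqVneq => // ->; rewrite ltnn !andbF.
Qed.

Lemma sgn_ins_D1 i I : sgn_ins R i (I :\ i) = sgn_ins R i I.
Proof.
rewrite /sgn_ins; congr (_ ^+ _); apply: eq_card => j; rewrite !inE.
by case: eqVneq => // ->; rewrite ltnn !andbF.
Qed.

(** The inversions of [(i |: K, I)] are those of [(K, I)] together with the pairs [(i, q)],
    [q \in I], [q < i]. *)
Lemma sgn_wedge_U1l i K I : i \notin K ->
  sgn_wedge R (i |: K) I = sgn_wedge R K I * sgn_ins R i I.
Proof.
move=> iK; rewrite /sgn_wedge /sgn_ins -exprD; congr (_ ^+ _).
have inj : injective (fun q : 'I_n => (i, q)) by move=> q q' [].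
rewrite -(card_imset _ inj) -cardsUI.
- rewrite [X in (_ + X)%N](_ : _ = 0%N) ?addn0.
    apply: eq_card => -[p q]; rewrite !inE /=.
    apply/and3P/orP => [[/predU1P[->|pK] qI qp]|[/and3P[pK qI qp]|]].
    + by right; apply/imsetP; exists q => //; rewrite inE qI.
    + by left; rewrite pK qI.
    + by rewrite pK orbT.
    + by move=> /imsetP[q' + [-> ->]]; rewrite inE => /andP[-> ->]; rewrite eqxx.
  apply: eq_card0 => -[p q]; rewrite !inE /=; apply/negP => /andP[/and3P[pK _ _]].
  by move=> /imsetP[q' _ [pE _]]; rewrite pE (negbTE iK) in pK.
Qed.

Lemma sgn_wedge_U1r i K I : i \notin I ->
  sgn_wedge R K (i |: I) =
  sgn_wedge R K I * (-1) ^+ #|[set j in K | (i < j)%N]%SET|.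
Proof.
move=> iI; rewrite /sgn_wedge -exprD; congr (_ ^+ _).
have inj : injective (fun p : 'I_n => (p, i)) by move=> p p' [].
rewrite -(card_imset _ inj) -cardsUI.
- rewrite [X in (_ + X)%N](_ : _ = 0%N) ?addn0.
    apply: eq_card => -[p q]; rewrite !inE /=.
    apply/and3P/orP => [[pK /predU1P[->|qI] qp]|[/and3P[pK qI qp]|]].
    + by right; apply/imsetP; exists p => //; rewrite inE pK.
    + by left; rewrite pK qI.
    + by rewrite qI orbT.
    + by move=> /imsetP[p' + [-> ->]]; rewrite inE => /andP[-> ->]; rewrite eqxx.
  apply: eq_card0 => -[p q]; rewrite !inE /=; apply/negP => /andP[/and3P[_ qI _]].
  by move=> /imsetP[q' _ [_ qE]]; rewrite qE (negbTE iI) in qI.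
Qed.

Lemma card_gt_lt i K : i \notin K ->
  (#|[set j in K | (i < j)%N]%SET| + #|[set j in K | (j < i)%N]%SET| = #|K|)%N.
Proof.
move=> iK; rewrite -cardsUI [X in (_ + X)%N](_ : _ = 0%N) ?addn0; last first.
  by apply: eq_card0 => j; rewrite !inE; case: ltngtP; rewrite ?andbF.
apply: eq_card => j; rewrite !inE; case: ltngtP => //= [||/val_inj ij];
  rewrite ?andbF ?orbF ?andbT ?orbT ?orbb//.
by rewrite -ij (negbTE iK).
Qed.

(* The sign of [d^* = +- * d *] does not depend on the differentiated
   variable; this is why [delta (hodge (koszul x b))] does not cancel. *)
Lemma sgn_codiff i I : i \notin I ->
  sgn_ins R i I * sgn_wedge R (~: (i |: I)) (i |: I) * sgn_ins R i (~: (i |: I)) =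
  sgn_wedge R (~: I) I * (-1) ^+ #|~: (i |: I)|.
Proof.
move=> iI; have iK : i \notin ~: (i |: I) by rewrite !inE eqxx.
have -> : ~: I = i |: ~: (i |: I).
  by apply/setP => j; rewrite !inE; case: eqVneq => // ->.
rewrite sgn_wedge_U1l// sgn_wedge_U1r// -(card_gt_lt iK) exprD /sgn_ins.
by ring.
Qed.

(** Set to zero on [J] so that sums run over all coordinates: every component of a Whitney form then
    has the shape [c + \sum_i x ord0 i * l i], which is the one the lemmas on measure and
    integration treat. *)
Definition koszul_coef b J i : R := if i \in J then 0 else sgn_ins R i J * b (i |: J).

Lemma koszulE x b J : koszul x b J = \sum_i x ord0 i * koszul_coef b J i.
Proof.
rewrite /koszul ffunE [RHS](bigID (fun i => i \in J)) /= [X in X + _]big1 ?add0r.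
  by apply: eq_big => // i iJ; rewrite /koszul_coef (negbTE iJ); ring.
by move=> i iJ; rewrite /koszul_coef iJ mulr0.
Qed.

Lemma partial_affine i (c : R) (f : 'I_n -> R) x :
  partial i (fun y => c + \sum_j y ord0 j * f j) x = f i.
Proof.
rewrite /partial /derive; apply: cvg_lim => //.
apply: (@cvg_trans _ ((fun=> f i) @ 0^')); last exact: cvg_cst.
apply: near_eq_cvg; near=> h => /=.
have h0 : h != 0 by near: h; exact: nbhs_dnbhs_neq.
rewrite opprD addrACA subrr add0r -sumrB.
rewrite (bigD1 i) //= big1 ?addr0 => [|j ji].
  by rewrite !mxE !eqxx /GRing.scale /=; field.
by rewrite !mxE (negbTE ji) !eqxx /GRing.scale /= mulr0 add0r subrr.
Unshelve. all: by end_near. Qed.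

(** The homotopy formula on constant forms: each [i \in J] contributes [b J], the two signs
    [sgn_ins] being equal, and [J] has [k.+1] elements unless [b J = 0]. *)
Lemma extd_whitney k a b x : kcovector k.+1 b ->
  extd (fun y => a + koszul y b) x = [ffun J => k.+1%:R * b J].
Proof.
move=> kb; apply/ffunP => J; rewrite !ffunE.
transitivity (\sum_(i in J) b J).
  apply: eq_bigr => i iJ.
  under [X in partial _ X]eq_fun do rewrite ffunE koszulE.
  rewrite partial_affine /koszul_coef !inE eqxx /= finset.setD1K// mulrA.
  by rewrite sgn_ins_D1 sgn_ins_sqr mul1r.
rewrite sumr_const -[LHS]mulr_natl; have [->//|Jk] := eqVneq #|J| k.+1.
by rewrite kb// !mulr0.
Qed.

Lemma koszul0 (x : 'rV[R]_n) : koszul x 0 = 0.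
Proof.
apply/ffunP => J; rewrite koszulE big1 ?ffunE// => i _.
by rewrite /koszul_coef ffunE mulr0 if_same mulr0.
Qed.

Lemma kcovector_koszul k (x : 'rV[R]_n) b : kcovector k.+1 b -> kcovector k (koszul x b).
Proof.
move=> kb J Jk; rewrite koszulE big1// => i _; rewrite /koszul_coef.
case: ifPn => iJ; first by rewrite mulr0.
by rewrite kb ?mulr0// cardsU1 iJ add1n eqSS.
Qed.

Lemma kcovectorD k a b : kcovector k a -> kcovector k b -> kcovector k (a + b).
Proof. by move=> ka kb J Jk; rewrite ffunE ka// kb// addr0. Qed.

Definition whitney_star_cst a J : R := sgn_wedge R (~: J) J * a (~: J).

Definition whitney_star_lin b J i : R :=
  sgn_wedge R (~: J) J * koszul_coef b (~: J) i.

Lemma hodge_whitneyE a b (x : 'rV[R]_n) J :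
  hodge (a + koszul x b) J =
  whitney_star_cst a J + \sum_i x ord0 i * whitney_star_lin b J i.
Proof.
rewrite /hodge ffunE ffunE koszulE mulrDr mulr_sumr; congr (_ + _).
by apply: eq_bigr => i _; rewrite mulrCA.
Qed.

(* The constant value of the codifferential of [hodge (a + koszul x b)]. *)
Definition whitney_star_codiff b : covector R n :=
  [ffun I : {set 'I_n} => - \sum_(i | i \notin I) sgn_ins R i I * whitney_star_lin b (i |: I) i].

(** By [sgn_codiff] the terms indexed by [i \notin I] are all equal, whence the factor [#|~: I|]. *)
Lemma whitney_star_codiffE b I : whitney_star_codiff b I =
  - (sgn_wedge R (~: I) I * (-1) ^+ #|~: I|.-1 * (#|~: I|)%:R * b (~: I)).
Proof.
rewrite ffunE; congr (- _).
transitivity (\sum_(i in ~: I) sgn_wedge R (~: I) I * (-1) ^+ #|~: I|.-1 * b (~: I)).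
  apply: eq_big => [i|i iI]; first by rewrite inE.
  have iK : i \notin ~: (i |: I) by rewrite !inE eqxx.
  have nI : ~: I = i |: ~: (i |: I).
    by apply/setP => j; rewrite !inE; case: eqVneq => // ->.
  rewrite /whitney_star_lin /koszul_coef (negbTE iK) -nI !mulrA sgn_codiff//.
  by rewrite nI cardsU1 iK.
by rewrite sumr_const -mulr_natl; ring.
Qed.

(** For the index sets considered, [#|~: I| = k.+1], so the numerical factor in front of [b (~: I)]
    is a nonzero multiple of a sign. *)
Lemma whitney_star_codiff_eq0 k b : kcovector k.+1 b ->
  (forall I, (#|I| + k.+1 = n)%N -> whitney_star_codiff b I = 0) -> b = 0.
Proof.
move=> kb b0; apply/ffunP => J; rewrite [RHS]ffunE.
have [Jk|] := eqVneq #|J| k.+1; last exact: kb.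
have := b0 (~: J); rewrite whitney_star_codiffE finset.setCK -Jk.
rewrite addnC cardsC card_ord => /(_ erefl)/eqP.
rewrite oppr_eq0 !mulf_eq0 !signr_eq0 /= pnatr_eq0 {1}Jk /=.
by move/eqP.
Qed.

Lemma hodge0 : hodge (0 : covector R n) = 0.
Proof. by apply/ffunP => J; rewrite !ffunE mulr0. Qed.

Lemma kcovector_hodge k (a : covector R n) : (k <= n)%N -> kcovector (n - k) a -> kcovector k (hodge a).
Proof.
move=> kn ka J Jk; rewrite ffunE ka ?mulr0//; apply: contra_neq Jk => Jk.
by have := cardsC J; rewrite card_ord Jk; lia.
Qed.

End whitney_algebra.

(** * Lebesgue measure on [R^n] *)

Section measure_rV.
Context (R : realType).
Local Notation mu n := (lebesgue_rV R n).

Lemma measurable_aff n (c : R) (l : 'I_n -> R) :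
  measurable_fun [set: 'rV[R]_n] (fun v => c + \sum_i v ord0 i * l i).
Proof.
apply: measurable_funD => //.
apply: measurable_sum => i; apply: measurable_funM => //.
exact: measurable_rV_coor.
Qed.

Lemma measurable_aff_eq0 n (c : R) (l : 'I_n -> R) :
  measurable [set v : 'rV[R]_n | c + \sum_i v ord0 i * l i = 0].
Proof.
rewrite -[X in measurable X]setTI.
apply: (measurable_aff c l measurableT (Y := [set 0])).
exact: measurable_set1.
Qed.

(** Induction on the dimension by slicing along the first coordinate: almost every slice is again
    the zero set of a nonzero affine function. *)
Lemma lebesgue_rV_aff_eq0 n (c : R) (l : 'I_n -> R) :
  c != 0 \/ (exists i, l i != 0) ->
  mu n [set v | c + \sum_i v ord0 i * l i = 0] = 0%E.
Proof.
elim: n c l => [|n IH] c l cl.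
  rewrite (_ : [set v | _] = set0) ?measure0// -subset0 => v /=.
  rewrite big_ord0 addr0; case: cl => [/eqP//|[[]]//].
pose A : set 'rV[R]_n.+1 := [set v | c + \sum_i v ord0 i * l i = 0].
change (mu n.+1 A = 0%E).
have mA : measurable A by exact: measurable_aff_eq0.
have mB : measurable (@rV_cons R n @^-1` A).
  by rewrite -[X in measurable X]setTI; exact: measurable_rV_cons.
change ((@lebesgue_measure R \x mu n)%E (@rV_cons R n @^-1` A) = 0%E).
(* [N] collects the first coordinates whose slice is the whole space. It is empty unless [l ord0] is
   the only nonzero slope, and then it is the point [- c / l ord0]. *)
have [N [mN N0 NA]] : exists N : set (measurableTypeR R),
  [/\ measurable N, lebesgue_measure N = 0%E & forall x, ~ N x ->
     c + x * l ord0 != 0 \/ (exists i, l (lift ord0 i) != 0)].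
  have [[i li]|] := pselect (exists i, l (lift ord0 i) != 0).
    by exists set0; split => // x _; right; exists i.
  move=> nl; have [l0|l0] := eqVneq (l ord0) 0.
    exists set0; split => // x _; left; rewrite l0 mulr0 addr0; case: cl => // -[i].
    case: (unliftP ord0 i) => [j ->|-> /eqP//] lj.
    by exfalso; apply: nl; exists j.
  exists [set - c / l ord0]; split => [||x nx].
  - exact: measurable_set1.
  - exact: lebesgue_measure_set1.
  left; apply: contra_notN nx => /eqP cx /=.
  by apply: (mulIf l0); rewrite divfK//; lra.
rewrite /product_measure1 -[RHS](integral0 (@lebesgue_measure R) setT).
apply: ae_eq_integral => //.
  exact: measurable_fun_xsection.
exists N; split => // x /=; rewrite -[X in _ -> X]notK; apply: contra_not => nx _.
rewrite -(IH (c + x * l ord0) (fun i => l (lift ord0 i)) (NA _ nx)).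
congr (lebesgue_rV _ _ _).
have consE v : c + \sum_i rV_cons (x, v) ord0 i * l i =
    c + x * l ord0 + \sum_i v ord0 i * l (lift ord0 i).
  rewrite big_ord_recl mxE unlift_none /= addrA; congr (_ + _).
  by apply: eq_bigr => i _; rewrite mxE liftK.
by apply/seteqP; split => v; rewrite /xsection /= ?inE /A /preimage /= consE.
Qed.

(** Induction along the recursive definition of the measure: Tonelli gives integrability on the
    product, Fubini the value. *)
Lemma integral_rV_prod n (g : 'I_n -> R -> R) :
  (forall i, lebesgue_measure.-integrable setT (EFin \o g i)) ->
  (mu n).-integrable setT (fun v => (\prod_i g i (v ord0 i))%:E) /\
  (\int[mu n]_v (\prod_i g i (v ord0 i))%:E =
    (\prod_i \int[lebesgue_measure]_x g i x)%:E)%E.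
Proof.
elim: n g => [|n IH] g ig.
  have -> : (fun v : 'rV[R]_0 => (\prod_i g i (v ord0 i))%:E) = cst 1%E.
    by apply/funext => v; rewrite big_ord0.
  split; last first.
    by rewrite integral_cst// /= diracT mul1e big_ord0.
  apply/integrableP; split => //.
  by rewrite /= normr1 integral_cst// /= diracT mul1e ltry.
have [iG GE] := IH _ (fun i => ig (lift ord0 i)).
set G := (fun v : 'rV[R]_n => \prod_i g (lift ord0 i) (v ord0 i)) in iG GE.
pose f (p : measurableTypeR R * 'rV[R]_n) : \bar R := (g ord0 p.1 * G p.2)%:E.
have mg0 : measurable_fun setT (g ord0) by have /measurable_EFinP := measurable_int _ (ig ord0).
have mG : measurable_fun setT G by have /measurable_EFinP := measurable_int _ iG.
have mf : measurable_fun setT f.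
  apply/measurable_EFinP; apply: measurable_funM.
    by apply: (measurableT_comp mg0); exact: measurable_fst.
  by apply: (measurableT_comp mG); exact: measurable_snd.
have inf : (lebesgue_measure \x mu n)%E.-integrable setT f.
  apply/integrable12ltyP => //.
  rewrite (_ : (fun x => _) = (fun x => `|(g ord0 x)%:E| * \int[mu n]_y `|(G y)%:E|)%E); last first.
    apply/funext => x; rewrite -ge0_integralZl//.
    - by apply: eq_integral => v _; rewrite /f /= normrM EFinM.
    - by apply: measurableT_comp => //; exact/measurable_EFinP.
  rewrite ge0_integralZr//.
  - apply: lte_mul_pinfty => //.
    + exact: integral_ge0.
    + by rewrite ge0_fin_numE; [case/integrableP: (ig ord0)|exact: integral_ge0].
    + by case/integrableP: iG.
  - by apply: measurableT_comp => //; exact/measurable_EFinP.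
  - exact: integral_ge0.
have fE : ((fun v : 'rV[R]_n.+1 => (\prod_i g i (v ord0 i))%:E) \o @rV_cons R n) = f.
  apply/funext => -[x v]; rewrite /f /= big_ord_recl /rV_cons mxE unlift_none /=.
  by congr (_ * _)%:E; apply: eq_bigr => i _; rewrite mxE liftK.
have mprod : measurable_fun [set: 'rV[R]_n.+1] (fun v => (\prod_i g i (v ord0 i))%:E).
  apply/measurable_EFinP; apply: measurable_prod => i _.
  apply: measurableT_comp (measurable_rV_coor _).
  by have /measurable_EFinP := measurable_int _ (ig i).
split.
  apply: (@integrable_pushforward _ _ _ _ _ _ (@measurable_rV_cons R n)) => //.
  by rewrite fE.
transitivity (\int[lebesgue_measure \x mu n]_p f p)%E.
  rewrite [LHS](@integral_pushforward _ _ _ _ _ _ (@measurable_rV_cons R n)) ?fE//.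
rewrite -integral12_prod_meas1// /fubini_F.
rewrite (_ : (fun x => _) = (fun x => (g ord0 x)%:E * (\prod_(i < n) \int[lebesgue_measure]_x g (lift ord0 i) x)%:E)%E); last first.
  by apply/funext => x; rewrite -GE -integralZl//.
rewrite integralZr//; last exact: ig.
rewrite big_ord_recl EFinM /Rintegral fineK//.
apply: integrable_fin_num => //; exact: ig.
Qed.

End measure_rV.

(** * Boxes as a countable base of the topology and as generators of the measurable sets *)

Section boxes.
Context (R : realType) (n : nat).
Local Notation mu := (lebesgue_rV R n).
Implicit Types (a b x : 'rV[R]_n) (A : set 'rV[R]_n).

Definition obox a b : set 'rV[R]_n := [set v | forall i, a ord0 i < v ord0 i < b ord0 i].
Definition cbox a b : set 'rV[R]_n := [set v | forall i, a ord0 i <= v ord0 i <= b ord0 i].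

Lemma obox_sub_cbox a b : obox a b `<=` cbox a b.
Proof. by move=> v vab i; have /andP[/ltW -> /ltW ->] := vab i. Qed.

Lemma measurable_rV_setprod (B : 'I_n -> set (measurableTypeR R)) : (forall i, measurable (B i)) ->
  measurable [set v : 'rV[R]_n | forall i, B i (v ord0 i)].
Proof.
move=> mB; rewrite (_ : [set v | _] =
  \bigcap_(i in [set: 'I_n]) (rV_coor i @^-1` B i)); last first.
  by apply/seteqP; split => v /= h i; [move=> _|]; exact: h.
apply: fin_bigcap_measurable => // i _.
by rewrite -[X in measurable X]setTI; exact: measurable_rV_coor.
Qed.

Lemma oboxE a b : obox a b = [set v | forall i, `]a ord0 i, b ord0 i[%classic (v ord0 i)].
Proof. by apply/seteqP; split => v vab i; have := vab i; rewrite /= in_itv. Qed.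

Lemma measurable_obox a b : measurable (obox a b).
Proof.
rewrite oboxE.
by apply: (@measurable_rV_setprod (fun i => `]a ord0 i, b ord0 i[%classic)) => i.
Qed.

Lemma compact_cbox a b : compact (cbox a b).
Proof.
rewrite (_ : cbox a b = [set v | forall i, `[a ord0 i, b ord0 i]%classic (v ord0 i)]).
  apply: (@rV_compact _ _ (fun i => `[a ord0 i, b ord0 i]%classic)) => i.
  exact: segment_compact.
by apply/seteqP; split => v vab i; have := vab i; rewrite /= in_itv.
Qed.

Lemma closed_cbox a b : closed (cbox a b).
Proof. exact: (compact_closed (@norm_hausdorff _ _) (@compact_cbox a b)). Qed.

Lemma lebesgue_rV_obox a b : (forall i, a ord0 i <= b ord0 i) ->
  mu (obox a b) = (\prod_i (b ord0 i - a ord0 i))%:E.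
Proof.
move=> ab; rewrite oboxE.
rewrite [LHS](@lebesgue_rV_box R n (fun i => `]a ord0 i, b ord0 i[%classic)); last first.
  by move=> i; exact: measurable_itv.
rewrite -prodEFin; apply: eq_bigr => i _; rewrite lebesgue_measure_itv /= lte_fin.
case: ltP => // ba; rewrite (_ : b ord0 i - a ord0 i = 0)//.
by apply/eqP; rewrite subr_eq0 eq_le ba ab.
Qed.

(** Rational corners make the family countable, so that open sets are countable unions of boxes and
    one null set per box can be tolerated. *)
Definition rat_box (q : 'rV[rat]_n * 'rV[rat]_n) : 'rV[R]_n * 'rV[R]_n :=
  (map_mx ratr q.1, map_mx ratr q.2).

Lemma open_rat_box A x : open A -> A x -> exists q,
  obox (rat_box q).1 (rat_box q).2 x /\ cbox (rat_box q).1 (rat_box q).2 `<=` A.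
Proof.
move=> oA Ax; have /nbhs_ballP[e /= e0 xeA] := open_nbhs_nbhs (conj oA Ax).
have /(_ _)/cid2-/all_sig2[q1 q1l q1r] : forall i, exists2 q : rat,
    x ord0 i - e < ratr q & ratr q < x ord0 i.
  move=> i; have /rat_in_itvoo[q] : x ord0 i - e < x ord0 i by lra.
  by rewrite in_itv /= => /andP[? ?]; exists q.
have /(_ _)/cid2-/all_sig2[q2 q2l q2r] : forall i, exists2 q : rat,
    x ord0 i < ratr q & ratr q < x ord0 i + e.
  move=> i; have /rat_in_itvoo[q] : x ord0 i < x ord0 i + e by lra.
  by rewrite in_itv /= => /andP[? ?]; exists q.
exists (\row_i q1 i, \row_i q2 i); split => [i|v vq].
  by rewrite !mxE q1r q2l.
apply: xeA; split => // i j; rewrite ord1; have := vq j; rewrite !mxE.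
have := q1l j; have := q2r j; rewrite /ball /= ltr_norml; lra.
Qed.

Lemma open_bigcup_rat_box A : open A -> A = \bigcup_(q in
    [set q | cbox (rat_box q).1 (rat_box q).2 `<=` A]) obox (rat_box q).1 (rat_box q).2.
Proof.
move=> oA; apply/seteqP; split => [x Ax|x [q qA /obox_sub_cbox]]; last exact: qA.
by have [q [xq qA]] := open_rat_box oA Ax; exists q.
Qed.

Lemma open_rV_measurable A : open A -> measurable A.
Proof.
move=> oA; rewrite (open_bigcup_rat_box oA).
rewrite bigcup_mkcond; apply: countable_bigcupT_measurable => [|q].
  exact: countableP.
by case: ifP => // _; exact: measurable_obox.
Qed.

Lemma open_rV_measure_gt0 A : open A -> A !=set0 -> (0 < mu A)%E.
Proof.
move=> oA [x Ax]; have [q [xq qA]] := open_rat_box oA Ax.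
have sub : obox (rat_box q).1 (rat_box q).2 `<=` A.
  exact: subset_trans (@obox_sub_cbox _ _) qA.
apply: (@lt_le_trans _ _ (mu (obox (rat_box q).1 (rat_box q).2))); last first.
  by apply: le_measure => //; rewrite inE; [exact: measurable_obox|exact: open_rV_measurable].
have lt12 i : (rat_box q).1 ord0 i < (rat_box q).2 ord0 i.
  by have /andP[] := xq i; exact: lt_trans.
rewrite lebesgue_rV_obox; last by move=> i; exact: ltW.
by rewrite lte_fin; apply: prodr_gt0 => i _; rewrite subr_gt0.
Qed.

Lemma bounded_rV_measure_lty A (M : R) : measurable A ->
  (forall v, A v -> forall i, `|v ord0 i| < M) -> (mu A < +oo)%E.
Proof.
move=> mA AM; pose b : 'rV[R]_n := const_mx `|M|.
apply: (@le_lt_trans _ _ (mu (obox (- b) b))).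
  apply: le_measure => //; rewrite ?inE//; first exact: measurable_obox.
  by move=> v /AM vM i; rewrite !mxE -ltr_norml (lt_le_trans (vM i))// ler_norm.
by rewrite lebesgue_rV_obox ?ltry// => i; rewrite !mxE; have := normr_ge0 M; lra.
Qed.

(** It suffices to reach the half-spaces bounding one coordinate from below, and these are unions
    over [m] of boxes cut off at [- m] and [m]. *)
Lemma rV_measurable_g_obox A : measurable A ->
  <<s [set B | exists a b, B = obox a b] >> A.
Proof.
set G := [set B | _]; have sG := smallest_sigma_algebra setT G.
apply: smallest_sub => //; rewrite -bigcup_seq; apply: bigcup_sub => i _.
move=> _ [B mB <-]; rewrite setTI; move: mB.
have -> : measurable B = ((@RGenOInfty.G R).-sigma.-measurable B).
  by rewrite -RGenOInfty.measurableE.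
pose H : set (set R) := [set B | <<s G >> (rV_coor i @^-1` B)].
suff sH : <<s (@RGenOInfty.G R) >> `<=` H by move=> /sH.
apply: smallest_sub.
  case: sG => s0 sC sU; split.
  - by rewrite /H /= preimage_set0.
  - by move=> X HX; rewrite /H /= setTD preimage_setC -setTD; exact: sC.
  - by move=> F HF; rewrite /H /= preimage_bigcup; exact: sU.
move=> _ [c ->]; rewrite /H /=.
rewrite (_ : _ @^-1` _ = \bigcup_m obox
    (\row_j (if j == i then c else - m%:R)) (const_mx m%:R)); last first.
  apply/seteqP; split => v /=; rewrite /rV_coor /= ?in_itv /= ?andbT.
    move=> cv; pose m := (Num.truncn (\sum_j `|v ord0 j|)).+1.
    have vm j : `|v ord0 j| < m%:R.
      apply: (@le_lt_trans _ _ (\sum_j `|v ord0 j|)); last exact: Num.Theory.truncnS_gt.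
      by rewrite (bigD1 j)//= lerDl sumr_ge0.
    exists m => // j; rewrite !mxE; have := vm j; rewrite ltr_norml => /andP[vl ->].
    by rewrite andbT; case: eqVneq => [->|_].
  by move=> [m _] /(_ i); rewrite !mxE eqxx => /andP[].
case: sG => s0 sC sU; apply: sU => m.
by apply: sub_sigma_algebra; do 2 eexists; reflexivity.
Qed.

Lemma oboxI a b c d : obox a b `&` obox c d =
  obox (\row_i Num.max (a ord0 i) (c ord0 i)) (\row_i Num.min (b ord0 i) (d ord0 i)).
Proof.
apply/seteqP; split => v /=.
  move=> [ab cd] i; rewrite !mxE gt_max lt_min.
  by have /andP[-> ->] := ab i; have /andP[-> ->] := cd i.
move=> h; split => i; have := h i; rewrite !mxE gt_max lt_min;
  by move=> /andP[/andP[va vc] /andP[vb vd]]; apply/andP.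
Qed.

End boxes.

(** * Bump functions *)

Section smooth_functions_of_one_variable.
Context {R : realType}.
Implicit Types (f g : R -> R) (a b t : R) (P : {poly R}).

(** The derivative is a witness rather than an iterate of [derive1]; stability under sums, products
    and affine substitution is then a plain induction on [m]. *)
Fixpoint diffn (m : nat) f : Prop :=
  if m is m'.+1 then exists2 g, (forall t, is_derive t 1 f (g t)) & diffn m' g
  else True.

Definition smooth1 f := forall m, diffn m f.

Lemma diffnS m f : diffn m.+1 f -> diffn m f.
Proof.
elim: m f => // m IH f [g fg dg]; exists g => //; exact: IH.
Qed.

Lemma diffnD m f g : diffn m f -> diffn m g -> diffn m (f \+ g).
Proof.
elim: m f g => // m IH f g [f' ff' df'] [g' gg' dg'].
exists (f' \+ g'); last exact: IH.
by move=> t; exact: is_deriveD.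
Qed.

Lemma diffnM m f g : diffn m f -> diffn m g -> diffn m (f \* g).
Proof.
elim: m f g => // m IH f g /[dup] /diffnS df [f' ff' df'] /[dup] /diffnS dg [g' gg' dg'].
exists ((f \* g') \+ (g \* f')); first by move=> t; exact: is_deriveM.
by apply: diffnD; exact: IH.
Qed.

Lemma diffn_cst m a : diffn m (cst a).
Proof.
elim: m a => // m IH a; exists (cst 0); last exact: IH.
by move=> t; exact: is_derive_cst.
Qed.

Lemma diffn_comp_aff m f a b : diffn m f -> diffn m (fun t => f (a * t + b)).
Proof.
elim: m f => // m IH f [f' ff' df'].
exists ((fun t => f' (a * t + b)) \* cst a).
  move=> t; apply: (is_derive1_comp (f := f) (g := fun t => a * t + b)) => //.
  by apply: is_derive_eq; rewrite /GRing.scale /=; ring.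
by apply: diffnM; [exact: IH|exact: diffn_cst].
Qed.

Lemma smooth1_derive f t : smooth1 f -> is_derive t 1 f (derive1 f t).
Proof. by move=> /(_ 1%N)[g /(_ t) fg _]; rewrite derive1E derive_val. Qed.

Lemma smooth1_derive1 f : smooth1 f -> smooth1 (derive1 f).
Proof.
move=> sf m; have [g fg dg] := sf m.+1; rewrite (_ : derive1 f = g)//.
by apply/funext => t; rewrite derive1E derive_val.
Qed.

Lemma smooth1M f g : smooth1 f -> smooth1 g -> smooth1 (f \* g).
Proof. by move=> sf sg m; exact: diffnM. Qed.

Lemma smooth1_id : smooth1 id.
Proof.
by case=> // m; exists (cst 1) => [t|]; [exact: is_derive_id|exact: diffn_cst].
Qed.

Lemma smooth1_comp_aff f a b : smooth1 f -> smooth1 (fun t => f (a * t + b)).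
Proof. by move=> sf m; exact: diffn_comp_aff. Qed.

Lemma smooth1_continuous f : smooth1 f -> continuous f.
Proof.
move=> sf t; apply/differentiable_continuous/derivable1_diffP.
by have [] := smooth1_derive t sf.
Qed.

(** The classical flat function [exp (- 1 / t)]; the polynomial factor in [1 / t] makes the family
    stable under derivation. *)
Definition flat P t := if 0 < t then P.[t^-1] * expR (- t^-1) else 0.

(** The exponential series bounds [t^-1 ^+ i.+2] by the factorial of [i.+2] times [expR t^-1], which
    leaves two spare powers of [t]. A quadratic bound is what makes the difference quotient at [0]
    tend to [0]. *)
Lemma flat_le_sqr P : exists2 c, 0 <= c & forall t, `|flat P t| <= c * t ^+ 2.
Proof.
exists (\sum_(i < size P) `|P`_i| * (i.+2)`!%:R).
  by apply: sumr_ge0 => i _; rewrite mulr_ge0.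
move=> t; rewrite /flat; case: ifPn => [t0|_]; last first.
  by rewrite normr0 mulr_ge0 ?sqr_ge0// sumr_ge0// => i _; rewrite mulr_ge0.
rewrite horner_coef mulr_suml mulr_suml.
apply: le_trans (ler_norm_sum _ _ _) _; apply: ler_sum => i _.
rewrite !normrM -!mulrA ler_wpM2l// (ger0_norm (expR_ge0 _)).
have t10 : 0 <= t^-1 by rewrite invr_ge0 ltW.
rewrite ger0_norm ?exprn_ge0//.
have := expR_ge1Dxn i.+1 t10; rewrite expRN => e1.
have fi0 : (0 : R) < (i.+2)`!%:R by rewrite ltr0n fact_gt0.
have e2 : t^-1 ^+ i.+2 / (i.+2)`!%:R <= expR t^-1 by apply: le_trans e1; rewrite lerDr.
rewrite ler_pdivrMr ?expR_gt0//.
rewrite (_ : t^-1 ^+ i = (i.+2)`!%:R * t ^+ 2 * (t^-1 ^+ i.+2 / (i.+2)`!%:R)).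
  by rewrite ler_wpM2l// mulr_ge0 ?sqr_ge0// ltW.
by rewrite !exprS; field; rewrite gt_eqF//= gt_eqF.
Qed.

(** The chain rule for [t > 0] (the factor ['X^2] comes from the derivative of [t^-1]), local
    constancy for [t < 0], and [flat_le_sqr] at [0]. *)
Lemma is_derive_flat P t : is_derive t 1 (flat P) (flat ('X^2 * (P - deriv P)) t).
Proof.
rewrite {2}/flat; case: ifPn => [t0|].
  have h : is_derive t 1 (fun s => P.[s^-1] * expR (- s^-1))
      (('X^2 * (P - P^`())).[t^-1] * expR (- t^-1)).
    have dV : is_derive t 1 (fun s : R => s^-1) (- t ^- 2).
      have := @is_deriveV R id t 1 1; rewrite gt_eqF// => /(_ isT).
      by rewrite /GRing.scale /= mulr1; apply; exact: is_derive_id.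
    have dN : is_derive t 1 (fun s : R => - s^-1) (t ^- 2).
      by rewrite -[t ^- 2]opprK; exact: is_deriveN.
    have dP := @is_derive1_comp R (horner P) (fun s => s^-1) t _ _ (is_derive_poly P _) dV.
    have dE := @is_derive1_comp R expR (fun s => - s^-1) t _ _ (is_derive_expR _) dN.
    have dM := is_deriveM dP dE.
    apply: (is_derive_eq dM).
    by rewrite /GRing.scale /= !hornerE /=; field; rewrite gt_eqF.
  apply: near_eq_is_derive h; near=> s.
  by rewrite /flat ifT//; near: s; exact: lt_nbhsr.
rewrite -leNgt le_eqVlt => /predU1P[->|t0]; last first.
  apply: near_eq_is_derive (is_derive_cst 0 t 1); near=> s.
  rewrite /flat ifF//; apply/negbTE; rewrite -leNgt ltW//.
  by near: s; exact: lt_nbhsl.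
have [c c0 Pc] := flat_le_sqr P.
have h : (fun h => h^-1 *: ((flat P \o shift 0) (h *: 1) - flat P 0)) @ 0^' --> (0 : R).
  apply/cvgrPdist_le => e e0; near=> h.
  have h0 : h != 0 by near: h; exact: nbhs_dnbhs_neq.
  rewrite sub0r normrN /= /GRing.scale /= mulr1 addr0 {2}/flat ltxx subr0.
  rewrite normrM normfV ler_pdivrMl ?normr_gt0//.
  apply: le_trans (Pc h) _; rewrite -real_normK ?num_real// expr2 mulrA [leRHS]mulrC.
  rewrite ler_wpM2r//.
  apply: (@le_trans _ _ ((c + 1) * `|h|)); first by rewrite ler_wpM2r// lerDl.
  rewrite -ler_pdivlMl; last by rewrite ltr_wpDl.
  near: h; apply: dnbhs0_le; rewrite mulr_gt0// invr_gt0 ltr_wpDl//.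
by apply: DeriveDef; [apply/cvg_ex; exists 0|exact/cvg_lim].
Unshelve. all: by end_near. Qed.

Lemma smooth1_flat P : smooth1 (flat P).
Proof.
move=> m; elim: m P => // m IH P.
by exists (flat ('X^2 * (P - deriv P))) => // t; exact: is_derive_flat.
Qed.

(* Increases with [m] to the indicator function of the interval from [a] to [b]. *)
Definition bump a b (m : nat) t : R :=
  flat 1 (m.+1%:R * (t - a)) * flat 1 (m.+1%:R * (b - t)).

Lemma smooth1_bump a b m : smooth1 (bump a b m).
Proof.
rewrite (_ : bump a b m = (fun t => flat 1 (m.+1%:R * t + - m.+1%:R * a)) \*
    (fun t => flat 1 (- m.+1%:R * t + m.+1%:R * b))); last first.
  by apply/funext => t; rewrite /bump; congr (flat 1 _ * flat 1 _); ring.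
by apply: smooth1M; apply: smooth1_comp_aff; exact: smooth1_flat.
Qed.

Lemma flat1_itv t : 0 <= flat 1 t <= 1.
Proof.
rewrite /flat; case: ifPn => [t0|_]; last by rewrite lexx ler01.
by rewrite hornerE mul1r expR_ge0 -expR0 ler_expR oppr_le0 invr_ge0 ltW.
Qed.

Lemma bump_itv a b m t : 0 <= bump a b m t <= 1.
Proof.
have /andP[? ?] := flat1_itv (m.+1%:R * (t - a)).
have /andP[? ?] := flat1_itv (m.+1%:R * (b - t)).
by rewrite mulr_ge0//= mulr_ile1.
Qed.

Lemma bump_out a b m t : ~~ (a < t < b) -> bump a b m t = 0.
Proof.
rewrite negb_and -!leNgt /bump /flat => /orP[ta|bt].
  by rewrite ifF ?mul0r//; apply/negbTE; rewrite -leNgt pmulr_rle0 ?ltr0n// subr_le0.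
rewrite [X in _ * X]ifF ?mulr0//.
by apply/negbTE; rewrite -leNgt pmulr_rle0 ?ltr0n// subr_le0.
Qed.

Lemma bump_cvg a b t : a < t < b -> bump a b m t @[m --> \oo] --> (1 : R).
Proof.
have flat_cvg s : 0 < s -> flat 1 (m.+1%:R * s) @[m --> \oo] --> (1 : R).
  move=> s0; rewrite (_ : (fun m => _) = (fun m : nat => expR (- (m.+1%:R^-1 * s^-1)))); last first.
    by apply/funext => m; rewrite /flat ifT ?mulr_gt0// hornerE mul1r invfM.
  rewrite -[X in _ --> X]expR0; apply: continuous_cvg; first exact: continuous_expR.
  rewrite -[0 in X in _ --> X]oppr0; apply: cvgN.
  rewrite -[X in _ --> X](mul0r s^-1); apply: cvgMl.
  exact: cvg_harmonic.
move=> /andP[ta bt]; rewrite -[1]mulr1; apply: cvgM; apply: flat_cvg.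
  by rewrite subr_gt0.
by rewrite subr_gt0.
Qed.

Lemma integrable_supp f a b : continuous f -> (forall t, ~~ (a <= t <= b) -> f t = 0) ->
  lebesgue_measure.-integrable setT (EFin \o f).
Proof.
move=> cf f0.
rewrite (_ : EFin \o f = (EFin \o f) \_ `[a, b]).
  apply/(integrable_mkcond _ _).1; first exact: measurable_itv.
  apply: continuous_compact_integrable; first exact: segment_compact.
  exact: continuous_subspaceT.
apply/funext => t; rewrite patchE; case: ifPn => // /negP.
by rewrite inE /= in_itv /= => /negP /f0 /= ->.
Qed.

Lemma derive1_supp f a b t : (forall t, ~~ (a < t < b) -> f t = 0) ->
  ~~ (a <= t <= b) -> derive1 f t = 0.
Proof.
move=> f0 tab; rewrite derive1E (near_eq_derive (g := cst 0)); first exact: derive_cst.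
move: tab; rewrite negb_and -!ltNge => /orP[ta|bt]; near=> s; apply: f0.
  by rewrite negb_and -!leNgt ltW//; near: s; exact: lt_nbhsl.
by rewrite negb_and -!leNgt orbC ltW//; near: s; exact: lt_nbhsr.
Unshelve. all: by end_near. Qed.

Lemma Rintegral_derive1_supp f a b : a < b -> smooth1 f ->
  (forall t, ~~ (a < t < b) -> f t = 0) ->
  \int[lebesgue_measure]_t derive1 f t = 0.
Proof.
move=> ab sf f0.
rewrite (_ : derive1 f = (derive1 f) \_ `[a, b]); last first.
  apply/funext => t; rewrite patchE; case: ifPn => // /negP.
  by rewrite inE /= in_itv /= => /negP; exact: derive1_supp.
rewrite -Rintegral_mkcond /Rintegral (@continuous_FTC2 _ _ f)//.
- by rewrite !f0 ?ltxx ?andbF// -EFinB subr0.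
- exact/continuous_subspaceT/smooth1_continuous/smooth1_derive1.
split => [t _||]; first by have [] := smooth1_derive t sf.
- exact/cvg_at_right_filter/smooth1_continuous.
- exact/cvg_at_left_filter/smooth1_continuous.
Qed.

(** Integration by parts, obtained by applying [Rintegral_derive1_supp] to [t * f t], which vanishes
    outside the same interval. *)
Lemma Rintegral_id_derive1_supp f a b : a < b -> smooth1 f ->
  (forall t, ~~ (a < t < b) -> f t = 0) ->
  \int[lebesgue_measure]_t (t * derive1 f t) = - \int[lebesgue_measure]_t f t.
Proof.
move=> ab sf f0.
have sM := smooth1M smooth1_id sf.
have := Rintegral_derive1_supp ab sM.
have dE t : derive1 (id \* f) t = t * derive1 f t + f t.
  rewrite derive1E.
  have dM := is_deriveM (is_derive_id t (1 : R)) (smooth1_derive t sf).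
  by rewrite derive_val /GRing.scale /= mulr1.
under eq_Rintegral do rewrite dE.
rewrite RintegralD//; last 2 first.
- apply: (@integrable_supp _ a b) => [|t tab].
    apply: smooth1_continuous; apply: smooth1M; first exact: smooth1_id.
    exact: smooth1_derive1.
  by rewrite (derive1_supp f0)// mulr0.
- apply: (@integrable_supp _ a b) => [|t tab]; first exact: smooth1_continuous.
  by apply: f0; apply: contra tab => /andP[/ltW -> /ltW ->].
move=> h; apply/eqP; rewrite -addr_eq0 h// => t /f0 ft.
by rewrite /= ft mulr0.
Qed.

End smooth_functions_of_one_variable.

Lemma cvg_bigprod (R : realType) (I T : Type) (F : set_system T) (FF : Filter F)
    (r : seq I) (P : pred I) (f : I -> T -> R) (l : I -> R) :
  (forall i, P i -> f i x @[x --> F] --> l i) ->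
  (\prod_(i <- r | P i) f i x) @[x --> F] --> \prod_(i <- r | P i) l i.
Proof.
move=> fl; elim: r => [|i r IH].
  by under eq_fun do rewrite big_nil; rewrite big_nil; exact: cvg_cst.
under eq_fun do rewrite big_cons; rewrite big_cons.
by case: ifPn => // Pi; apply: cvgM => //; exact: fl.
Qed.

Lemma integrable_cstM d (T : measurableType d) (R : realType)
    (mu : {measure set T -> \bar R}) (D : set T) (c : R) (f : T -> R) :
  measurable D -> mu.-integrable D (EFin \o f) ->
  mu.-integrable D (fun x => (c * f x)%:E).
Proof.
move=> mD fi; rewrite (_ : (fun _ => _) = (fun x => c%:E * (EFin \o f) x)%E).
  exact: integrableZl.
by apply/funext => x; rewrite EFinM.
Qed.

(** * Products of one-variable bump functions, and integration by parts against affine functions *)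

Section product_test_functions.
Context {R : realType} {n : nat}.
Local Notation mu := (lebesgue_rV R n).
Implicit Types (f : 'I_n -> R -> R) (a b v : 'rV[R]_n) (i j : 'I_n).

Definition prodfn f v : R := \prod_i f i (v ord0 i).

Definition derive_at i f : 'I_n -> R -> R :=
  fun j => if j == i then derive1 (f i) else f j.

Lemma smooth1_derive_at i f : (forall j, smooth1 (f j)) ->
  forall j, smooth1 (derive_at i f j).
Proof.
by move=> sf j; rewrite /derive_at; case: ifP => // _; exact: smooth1_derive1.
Qed.

Lemma is_derive_prodfn i f v : (forall j, smooth1 (f j)) ->
  is_derive v (delta_mx ord0 i) (prodfn f) (prodfn (derive_at i f) v).
Proof.
move=> sf; pose C := \prod_(j | j != i) f j (v ord0 j).
have [df dfE] := smooth1_derive (v ord0 i) (sf i).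
have quotE : (fun h : R => h^-1 *: ((prodfn f \o shift v) (h *: delta_mx ord0 i) - prodfn f v))
  = (fun h => C * (h^-1 *: ((f i \o shift (v ord0 i)) (h *: 1) - f i (v ord0 i)))).
  apply/funext => h; rewrite /prodfn /= (bigD1 i)//= [X in _ - X](bigD1 i)//= -/C.
  rewrite (eq_bigr (fun j => f j (v ord0 j))) -/C; last first.
    by move=> j ji; rewrite !mxE (negbTE ji) mulr0 add0r.
  by rewrite !mxE !eqxx /GRing.scale /=; ring.
have dE : prodfn (derive_at i f) v = C * derive1 (f i) (v ord0 i).
  rewrite /prodfn (bigD1 i)//= mulrC /derive_at eqxx; congr (_ * _).
  by apply: eq_bigr => j /negbTE ->.
have lim : (fun h : R => h^-1 *:
    ((prodfn f \o shift v) (h *: delta_mx ord0 i) - prodfn f v)) @ 0^' -->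
    prodfn (derive_at i f) v.
  rewrite quotE dE; apply: cvgMr.
  by move: df; rewrite /derivable => /cvg_ex[l hl]; rewrite -dfE /derive (cvg_lim _ hl).
by apply: DeriveDef; [apply/cvg_ex; eexists; exact: lim|exact/cvg_lim].
Qed.

Lemma partial_prodfn i f : (forall j, smooth1 (f j)) ->
  partial i (prodfn f) = prodfn (derive_at i f).
Proof.
by move=> sf; apply/funext => v; have dv := is_derive_prodfn i v sf; exact: derive_val.
Qed.

Lemma continuous_prodfn f : (forall j, continuous (f j)) -> continuous (prodfn f).
Proof.
move=> cf v; rewrite /prodfn; apply: (@cvg_bigprod _ _ _ _ (nbhs_filter v)) => j _.
by apply: (continuous_comp (g := f j)); [exact: coord_continuous|exact: cf].
Qed.

(** A partial derivative of a product of one-variable functions is again such a product, so iterated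
    derivatives never leave the class. *)
Lemma smooth_prodfn f : (forall j, smooth1 (f j)) -> smooth (prodfn f).
Proof.
move=> sf s.
have [g sg ->] : exists2 g, (forall j, smooth1 (g j)) &
    iter_partial s (prodfn f) = prodfn g.
  elim: s => [|i s [g sg IH]]; first by exists f.
  exists (derive_at i g); first exact: smooth1_derive_at.
  by rewrite /= IH partial_prodfn.
split; first by apply: continuous_prodfn => j; exact: smooth1_continuous.
by move=> i v; have [] := is_derive_prodfn i v sg.
Qed.

Lemma measurable_prodfn f : (forall j, continuous (f j)) ->
  measurable_fun setT (prodfn f).
Proof.
move=> cf; rewrite /prodfn; apply: measurable_prod => j _.
apply: (measurableT_comp (f := f j) _ (measurable_rV_coor j)).
exact: continuous_measurable_fun.
Qed.

Lemma integral_prodfn f :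
  (forall j, continuous (f j)) ->
  (forall j, exists a b : R, forall t, ~~ (a <= t <= b) -> f j t = 0) ->
  mu.-integrable setT (EFin \o prodfn f) /\
  \int[mu]_v prodfn f v = \prod_j \int[lebesgue_measure]_t f j t.
Proof.
move=> cf f0.
have [|if1 fE] := @integral_rV_prod R n f.
  by move=> j; have [a [b fab]] := f0 j; exact: (integrable_supp (cf j) fab).
by split => //; rewrite /Rintegral fE.
Qed.

Definition box_bump a b (m : nat) : 'rV[R]_n -> R :=
  prodfn (fun j => bump (a ord0 j) (b ord0 j) m).

Lemma smooth_box_bump a b m : smooth (box_bump a b m).
Proof. by apply: smooth_prodfn => j; exact: smooth1_bump. Qed.

Lemma box_bump_itv a b m v : 0 <= box_bump a b m v <= 1.
Proof.
rewrite prodr_ge0 => [|j _]; last by have /andP[] := bump_itv (a ord0 j) (b ord0 j) m (v ord0 j).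
by apply: prodr_ile1 => j _; exact: bump_itv.
Qed.

Lemma box_bump_out a b m v : ~ obox a b v -> box_bump a b m v = 0.
Proof.
move=> /existsNP[j /negP abj]; rewrite /box_bump /prodfn (bigD1 j)//=.
by rewrite bump_out ?mul0r.
Qed.

Lemma box_bump_cvg a b v : box_bump a b m v @[m --> \oo] --> (\1_(obox a b) v : R).
Proof.
rewrite indicE; have [abv|abv] := boolP (v \in obox a b).
  rewrite inE in abv.
  have -> : true%:R = \prod_(j < n) (1 : R) by rewrite big1.
  by apply: cvg_bigprod => // j _; apply: bump_cvg; exact: abv.
have {}abv : ~ obox a b v by move=> h; rewrite mem_set in abv.
by under eq_fun do rewrite box_bump_out//; exact: cvg_cst.
Qed.

Lemma partial_box_bump_out i a b m v : ~ cbox a b v -> partial i (box_bump a b m) v = 0.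
Proof.
move=> /existsNP[j /negP abj].
rewrite /box_bump partial_prodfn => [|l]; last exact: smooth1_bump.
rewrite /prodfn (bigD1 j)//= /derive_at; case: eqP => [<-|_]; last first.
  rewrite bump_out ?mul0r//; apply: contra abj => /andP[/ltW -> /ltW ->]//.
rewrite (@derive1_supp _ _ (a ord0 j) (b ord0 j)) ?mul0r// => t; exact: bump_out.
Qed.

Lemma measurable_box_bump a b m : measurable_fun setT (box_bump a b m).
Proof.
by apply: measurable_prodfn => j; apply: smooth1_continuous; exact: smooth1_bump.
Qed.

Lemma measurable_partial_box_bump i a b m :
  measurable_fun setT (partial i (box_bump a b m)).
Proof.
have sb j : smooth1 (bump (a ord0 j) (b ord0 j) m) by exact: smooth1_bump.
rewrite /box_bump partial_prodfn//; apply: measurable_prodfn => j.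
exact/smooth1_continuous/smooth1_derive_at.
Qed.

Lemma integrable_box_bump a b m : mu.-integrable setT (EFin \o box_bump a b m).
Proof.
have [|j|//] := @integral_prodfn (fun j => bump (a ord0 j) (b ord0 j) m).
  by move=> j; apply: smooth1_continuous; exact: smooth1_bump.
exists (a ord0 j), (b ord0 j) => t tab; apply: bump_out.
by apply: contra tab => /andP[/ltW -> /ltW ->].
Qed.

(** Every summand factorises into one-variable integrals. The constant and the terms [j != i] keep
    the factor [\int derive1 (f i) = 0]; the term [j = i] is integrated by parts in one variable. *)
Lemma integral_partial_box_bump i a b m (c : R) (l : 'I_n -> R) :
  (forall j, a ord0 j < b ord0 j) ->
  mu.-integrable setT (fun v => (partial i (box_bump a b m) v * (c + \sum_j v ord0 j * l j))%:E) /\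
  \int[mu]_v (partial i (box_bump a b m) v * (c + \sum_j v ord0 j * l j)) =
  - l i * \int[mu]_v box_bump a b m v.
Proof.
move=> ab; set f := fun j => bump (a ord0 j) (b ord0 j) m.
have sf j : smooth1 (f j) by exact: smooth1_bump.
have f0 j t : ~~ (a ord0 j < t < b ord0 j) -> f j t = 0 by exact: bump_out.
rewrite /box_bump partial_prodfn//; set F := derive_at i f.
have sF j : smooth1 (F j) by exact: smooth1_derive_at.
have F0 j t : ~~ (a ord0 j <= t <= b ord0 j) -> F j t = 0.
  rewrite /F /derive_at; case: eqP => [->|_] tab; first exact: (derive1_supp (f0 i)).
  by apply: f0; apply: contra tab => /andP[/ltW -> /ltW ->].
(* The coordinate [v ord0 j] is absorbed into the [j]-th factor, so that [v ord0 j * prodfn F v] is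
   again a product. *)
pose H j : 'I_n -> R -> R := fun k => if k == j then (fun t => t * F j t) else F k.
have sH j k : smooth1 (H j k).
  by rewrite /H; case: ifP => // _; apply: smooth1M => //; exact: smooth1_id.
have H0 j k t : ~~ (a ord0 k <= t <= b ord0 k) -> H j k t = 0.
  by move=> tab; rewrite /H; case: eqP tab => [->|_] tab; rewrite F0// mulr0.
have [|j|iF FE] := @integral_prodfn F.
- by move=> j; exact: smooth1_continuous.
- by exists (a ord0 j), (b ord0 j); exact: F0.
have iH j : mu.-integrable setT (EFin \o prodfn (H j)) /\
  \int[mu]_v prodfn (H j) v = \prod_k \int[lebesgue_measure]_t H j k t.
  apply: integral_prodfn => k; first exact: smooth1_continuous.
  by exists (a ord0 k), (b ord0 k); exact: H0.
have [|j|_ fE] := @integral_prodfn f.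
- by move=> j; exact: smooth1_continuous.
- exists (a ord0 j), (b ord0 j) => t tab; apply: f0.
  by apply: contra tab => /andP[/ltW -> /ltW ->].
have HE j v : v ord0 j * prodfn F v = prodfn (H j) v.
  rewrite /prodfn (bigD1 j)//= [RHS](bigD1 j)//= mulrA /H eqxx; congr (_ * _).
  by apply: eq_bigr => k /negbTE ->.
have sumE v : prodfn F v * (c + \sum_j v ord0 j * l j) =
    c * prodfn F v + \sum_j l j * prodfn (H j) v.
  rewrite mulrDr mulrC mulr_sumr; congr (_ + _); apply: eq_bigr => j _.
  by rewrite -HE; ring.
have iS : mu.-integrable setT (fun v => (\sum_j l j * prodfn (H j) v)%:E).
  rewrite (_ : (fun _ => _) = (fun v => \sum_j (l j * prodfn (H j) v)%:E)%E); last first.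
    by apply/funext => v; rewrite sumEFin.
  apply: integrable_sum => // j _.
  exact: (integrable_cstM (l j) measurableT (iH j).1).
have icF : mu.-integrable setT (fun v => (c * prodfn F v)%:E).
  exact: (integrable_cstM c measurableT iF).
split.
  rewrite (_ : (fun _ => _) = (fun v => (c * prodfn F v)%:E + (\sum_j l j * prodfn (H j) v)%:E)%E).
    exact: integrableD.
  by apply/funext => v; rewrite sumE EFinD.
under eq_Rintegral do rewrite sumE.
rewrite RintegralD// RintegralZl// FE.
have Fi0 : \int[lebesgue_measure]_t F i t = 0.
  rewrite /F /derive_at eqxx; exact: (Rintegral_derive1_supp (ab i) (sf i) (f0 i)).
rewrite [X in c * X](bigD1 i)//= Fi0 mul0r mulr0 add0r.
transitivity (\sum_j l j * \int[mu]_v prodfn (H j) v).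
  rewrite /Rintegral; under eq_integral do rewrite -sumEFin.
  rewrite integral_sum//; last first.
    by move=> j; apply: (integrableZl measurableT (l j) (iH j).1).
  rewrite -sum_fine; last first.
    move=> j _; apply: integrable_fin_num => //.
    exact: (integrable_cstM (l j) measurableT (iH j).1).
  by apply: eq_bigr => j _; exact: (RintegralZl (l j) measurableT (iH j).1).
rewrite (bigD1 i)//= big1 ?addr0 => [|j ji].
  rewrite (iH i).2 fE mulNr -mulrN; congr (_ * _).
  rewrite (bigD1 i)//= [in RHS](bigD1 i)//= -mulNr; congr (_ * _).
    rewrite /H eqxx /F /derive_at eqxx.
    exact: (Rintegral_id_derive1_supp (ab i) (sf i) (f0 i)).
  by apply: eq_bigr => k /negbTE ki; rewrite /H ki /F /derive_at ki.
rewrite (iH j).2 (bigD1 i)//= [X in _ * (X * _)](_ : _ = 0) ?mul0r ?mulr0//.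
by rewrite /H eq_sym (negbTE ji).
Qed.

End product_test_functions.

(** * The fundamental lemma of the calculus of variations *)

Section fundamental_lemma.
Context {R : realType} {n : nat}.
Local Notation mu := (lebesgue_rV R n).
Implicit Types (a b : 'rV[R]_n) (U Q : set 'rV[R]_n) (g : 'rV[R]_n -> R).

(** The bumps lie between [0] and [1] and tend to the indicator of the open box: dominated
    convergence with majorant [|g|]. *)
Lemma integral_obox_eq0 U g a b : open U -> mu.-integrable U (EFin \o g) ->
  (forall m, \int[mu]_(x in U) (box_bump a b m x * g x) = 0) ->
  obox a b `<=` U ->
  (\int[mu]_(x in obox a b) (g x)%:E = 0)%E.
Proof.
move=> oU ig g0 abU; have mU := open_rV_measurable oU.
have mQ := measurable_obox a b.
have mg : measurable_fun U g by have /measurable_EFinP := measurable_int _ ig.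
have mf m : measurable_fun U (fun x => box_bump a b m x * g x).
  by apply: measurable_funM => //; apply: measurable_funTS; exact: measurable_box_bump.
have le m x : `|box_bump a b m x * g x| <= `|g x|.
  have /andP[? ?] := box_bump_itv a b m x.
  by rewrite normrM ger0_norm// ler_piMl.
have [] := @dominated_convergence _ _ _ mu U mU
    (fun m x => (box_bump a b m x * g x)%:E)
    (fun x => (\1_(obox a b) x * g x)%:E) (fun x => `|g x|%:E).
- by move=> m; exact/measurable_EFinP.
- apply/measurable_EFinP; apply: measurable_funM => //.
- apply: aeW => x _; apply: cvg_EFin; first exact: nearW.
  by apply: cvgMl; exact: box_bump_cvg.
- exact: (integrable_norm (D := U) (f := g)).
- by apply: aeW => x m _; rewrite lee_fin.
move=> _ _; rewrite [X in X @ \oo --> _](_ : _ = cst 0%E); last first.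
  apply/funext => m /=; apply/eqP; rewrite -fine_eq0; first by apply/eqP; exact: g0.
  apply: integrable_fin_num => //; apply: le_integrable ig => //.
  - exact/measurable_EFinP.
  - by move=> x _; rewrite lee_fin.
move/cvg_lim => /(_ (@ereal_hausdorff _)); rewrite lim_cst// => {1}->.
rewrite -[in LHS](setIidr abU) integral_mkcondr.
apply: eq_integral => x _; rewrite patchE indicE.
by case: ifP => _; rewrite ?mul1r ?mul0r.
Qed.

(** The pi-lambda theorem: open boxes are stable under intersection and generate the measurable
    sets, so the integral of [g] vanishes on all measurable subsets of [Q]. *)
Lemma obox_integral_eq0_ae Q g a b :
  Q = obox a b -> mu.-integrable Q (EFin \o g) ->
  (forall c d, cbox c d `<=` cbox a b -> (\int[mu]_(x in obox c d) (g x)%:E = 0)%E) ->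
  {ae mu, forall x, Q x -> g x = 0}.
Proof.
move=> QE ig g0; have mQ : measurable Q by rewrite QE; exact: measurable_obox.
pose G := [set B | exists c d, B = @obox R n c d].
have GI : setI_closed G.
  by move=> _ _ [c [d ->]] [e [f ->]]; rewrite oboxI; do 2 eexists; reflexivity.
pose D := [set A | measurable A /\ (\int[mu]_(x in Q `&` A) (g x)%:E = 0)%E].
have dD : dynkin D.
  split.
  - by split => //; rewrite setIT QE; exact: g0.
  - move=> A [mA A0]; split; first exact: measurableC.
    have : (\int[mu]_(x in Q) (g x)%:E = 0)%E by rewrite QE; exact: g0.
    rewrite -[in X in X -> _](setIT Q) -(setUv A) setIUr integral_setU_EFin//=.
    + by rewrite A0 add0e.
    + exact: measurableI.
    + by apply: measurableI => //; exact: measurableC.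
    + rewrite -setIUr setUv setIT; by have /measurable_EFinP := measurable_int _ ig.
    + by apply/disj_set2P; rewrite setIACA setICr setI0.
  - move=> F tF DF; split; first by apply: bigcup_measurable => k _; exact: (DF k).1.
    rewrite setI_bigcupr integral_bigcup//=.
    + by rewrite eseries0// => k _ _; exact: (DF k).2.
    + exact: trivIset_setIl.
    + by move=> k; apply: measurableI => //; exact: (DF k).1.
    + apply: integrableS ig => //; last by rewrite -setI_bigcupr; exact: subIsetl.
      by apply: bigcup_measurable => k _; apply: measurableI => //; exact: (DF k).1.
have GD : <<s G >> `<=` D.
  rewrite -setI_closed_g_dynkin_g_sigma_algebra//; apply: smallest_sub => //.
  move=> _ [c [d ->]]; split; first exact: measurable_obox.
  rewrite QE oboxI; apply: g0 => v vab i; have := vab i.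
  by rewrite !mxE ge_max le_min => /andP[/andP[-> _] /andP[-> _]].
have : ae_eq mu Q (EFin \o g) (cst 0%E).
  apply: integral_ae_eq => // E EQ mE.
  by rewrite integral0 -(setIidr EQ); have [] := GD _ (rV_measurable_g_obox mE).
by apply: filterS => x /= h /h [].
Qed.

Lemma fundamental_lemma U g : open U -> mu.-integrable U (EFin \o g) ->
  (forall a b m, (forall i, a ord0 i < b ord0 i) -> cbox a b `<=` U ->
    \int[mu]_(x in U) (box_bump a b m x * g x) = 0) ->
  {ae mu, forall x, U x -> g x = 0}.
Proof.
move=> oU ig g0.
have box0 a b : cbox a b `<=` U -> (\int[mu]_(x in obox a b) (g x)%:E = 0)%E.
  move=> abU; have [ab|] := pselect (forall i, a ord0 i < b ord0 i).
    apply: (integral_obox_eq0 oU ig) => [m|]; first exact: g0.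
    exact: subset_trans (@obox_sub_cbox _ _ _ _) abU.
  move=> /existsNP[i abi]; rewrite (_ : obox a b = set0) ?integral_set0//.
  by rewrite -subset0 => v /(_ i)/andP[ai bi]; apply: abi; exact: lt_trans bi.
have aebox a b : cbox a b `<=` U -> {ae mu, forall x, obox a b x -> g x = 0}.
  move=> abU; have sub := subset_trans (@obox_sub_cbox _ _ a b) abU.
  apply: (obox_integral_eq0_ae erefl).
    by apply: integrableS ig => //; [exact: open_rV_measurable|exact: measurable_obox].
  by move=> c d cdab; apply: box0; exact: subset_trans abU.
(* Rational boxes are numbered by [nat] to take the union of countably many null sets; codes of no
   box, and boxes not inside [U], impose nothing. *)
pose P k x := if unpickle k is Some q then
  cbox (rat_box R q).1 (rat_box R q).2 `<=` U ->
  obox (rat_box R q).1 (rat_box R q).2 x -> g x = 0 else True.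
have : {ae mu, forall x, forall k, P k x}.
  apply: ae_foralln => k; rewrite /P; case: unpickle => [q|]; last exact: aeW.
  have [qU|qU] := pselect (cbox (rat_box R q).1 (rat_box R q).2 `<=` U).
    by apply: filterS (aebox _ _ qU) => x h _.
  by apply: aeW => x /qU.
apply: filterS => x Px Ux; have [q [xq qU]] := open_rat_box oU Ux.
by have := Px (pickle q); rewrite /P pickleK; exact.
Qed.

End fundamental_lemma.

(** * Simplices and subdivisions *)

Section simplices.
Context {R : realType} {n : nat}.
Local Notation mu := (lebesgue_rV R n).
Implicit Types (V W : 'M[R]_(n.+1, n)) (x : 'rV[R]_n) (Om : set 'rV[R]_n)
  (G : seq 'M[R]_(n.+1, n)).

(** Homogeneous coordinates: the extra column of ones turns the affine system for barycentric
    coordinates into a linear one. The format [(n.+1, n + 1)] is square only up to an identity of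
    naturals, hence the pseudo-inverse in [bary]. *)
Definition affine_mx V : 'M[R]_(n.+1, n + 1) := row_mx V (const_mx 1).

Definition bary V x : 'rV[R]_n.+1 := row_mx x (const_mx 1) *m pinvmx (affine_mx V).

Definition ocell V : set 'rV[R]_n := [set x | forall i, 0 < bary V x ord0 i].

Lemma mul_affine_mx V (l : 'rV[R]_n.+1) :
  l *m affine_mx V = row_mx (l *m V) (const_mx (\sum_i l ord0 i)).
Proof.
rewrite /affine_mx mul_mx_row; congr row_mx; apply/rowP => j; rewrite !mxE.
by apply: eq_bigr => i _; rewrite mxE mulr1.
Qed.

Lemma affine_mx_free V : affinely_independent V -> row_free (affine_mx V).
Proof.
move=> aV; rewrite -kermx_eq0; apply/eqP/row_matrixP => i; rewrite row0.
set l := row i _; have : l *m affine_mx V = 0 by apply/sub_kermxP; exact: row_sub.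
rewrite mul_affine_mx -[RHS]row_mx0 => /eq_row_mx[lV /rowP/(_ ord0)].
by rewrite !mxE => l0; exact: aV.
Qed.

Lemma affine_mx_full V : affinely_independent V -> row_full (affine_mx V).
Proof.
by move=> /affine_mx_free/eqP rV; rewrite /row_full [X in X == _]rV addn1.
Qed.

Lemma bary_mul V x : affinely_independent V -> bary V x *m V = x.
Proof.
move=> aV; have := mulVpmx (affine_mx_full aV) => h.
have : bary V x *m affine_mx V = row_mx x (const_mx 1) by rewrite /bary -mulmxA h mulmx1.
by rewrite mul_affine_mx => /eq_row_mx[].
Qed.

Lemma bary_sum V x : affinely_independent V -> \sum_i bary V x ord0 i = 1.
Proof.
move=> aV; have := mulVpmx (affine_mx_full aV) => h.
have : bary V x *m affine_mx V = row_mx x (const_mx 1) by rewrite /bary -mulmxA h mulmx1.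
by rewrite mul_affine_mx => /eq_row_mx[_ /rowP/(_ ord0)]; rewrite !mxE.
Qed.

Lemma baryK V (l : 'rV[R]_n.+1) : affinely_independent V ->
  \sum_i l ord0 i = 1 -> bary V (l *m V) = l.
Proof.
move=> aV l1; rewrite /bary -{}l1 -mul_affine_mx -mulmxA.
by rewrite mulmxVp ?mulmx1//; exact: affine_mx_free.
Qed.

Definition bary_cst V i : R := pinvmx (affine_mx V) (rshift n ord0) i.
Definition bary_lin V i (j : 'I_n) : R := pinvmx (affine_mx V) (lshift 1 j) i.

Lemma baryE V x i : bary V x ord0 i = bary_cst V i + \sum_j x ord0 j * bary_lin V i j.
Proof.
rewrite /bary mxE big_split_ord /= big_ord1 addrC row_mxEr mxE mul1r.
by congr (_ + _); apply: eq_bigr => j _; rewrite row_mxEl.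
Qed.

(** The [i]-th column of the inverse matrix is nonzero, because the [(i, i)] entry of the product is
    [1]. Hence the zero set of a barycentric coordinate is null. *)
Lemma bary_neq0 V i : affinely_independent V ->
  bary_cst V i != 0 \/ exists j, bary_lin V i j != 0.
Proof.
move=> aV; have [c0|] := eqVneq (bary_cst V i) 0; last by left.
right; apply: contrapT => /forallNP l0.
have /matrixP/(_ i i) := mulmxVp (affine_mx_free aV).
rewrite !mxE eqxx => /eqP; rewrite big1 ?(eq_sym 0) ?oner_eq0// => k _.
rewrite (_ : pinvmx _ k i = 0) ?mulr0//; case: (split_ordP k) => j ->.
  by have /negP/negPn/eqP := l0 j.
by rewrite ord1.
Qed.

Lemma faceE V (A : {set 'I_n.+1}) : affinely_independent V ->
  face V A = [set x | (forall i, 0 <= bary V x ord0 i) /\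
                      forall i, i \notin A -> bary V x ord0 i = 0].
Proof.
move=> aV; apply/seteqP; split => x /=.
  by move=> [l [l0 lA l1 ->]]; rewrite baryK.
by move=> [x0 xA]; exists (bary V x); split => //; rewrite ?bary_sum ?bary_mul.
Qed.

Lemma cellE V : affinely_independent V ->
  cell V = [set x | forall i, 0 <= bary V x ord0 i].
Proof.
move=> aV; rewrite /cell faceE//; apply/seteqP; split => x /= => [[]//|x0].
by split => // i; rewrite inE.
Qed.

Lemma ocell_cell V : affinely_independent V -> ocell V `<=` cell V.
Proof. by move=> aV; rewrite cellE// => x xV i; exact/ltW/xV. Qed.

Lemma continuous_bary V i : continuous (fun x => bary V x ord0 i).
Proof.
under eq_fun do rewrite baryE.
move=> x; suff aff (F : set_system 'rV[R]_n) : Filter F ->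
    (forall j, v ord0 j @[v --> F] --> x ord0 j) ->
    bary_cst V i + \sum_j v ord0 j * bary_lin V i j @[v --> F] -->
    bary_cst V i + \sum_j x ord0 j * bary_lin V i j.
  exact: (aff _ (nbhs_filter x) (fun j => @coord_continuous _ _ _ ord0 j x)).
move=> FF Fx; apply: cvgD; first exact: cvg_cst.
elim: (index_enum _) => [|j r IH].
  by under eq_fun do rewrite big_nil; rewrite big_nil; exact: cvg_cst.
under eq_fun do rewrite big_cons; rewrite big_cons; apply: cvgD => //.
by apply: cvgM => //; exact: cvg_cst.
Qed.

Lemma open_ocell V : open (ocell V).
Proof.
rewrite (_ : ocell V = \big[setI/setT]_(i < n.+1) [set x | 0 < bary V x ord0 i]).
  elim/big_ind: _ => [|A B|i _]; [exact: openT|exact: openI|].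
  apply: (@open_comp _ _ (fun x => bary V x ord0 i) [set y | 0 < y]).
    by move=> x _; exact: continuous_bary.
  exact: open_gt.
by rewrite -bigcap_seq; apply/seteqP; split => x /= h i;
  [move=> _; exact: h|apply: h; rewrite /= mem_index_enum].
Qed.

Lemma closed_cell V : affinely_independent V -> closed (cell V).
Proof.
move=> aV; rewrite cellE// (_ : [set x | _] =
    \bigcap_(i in [set: 'I_n.+1]) [set x | 0 <= bary V x ord0 i]).
  apply: closed_bigI => i _.
  apply: (@closed_comp _ _ (fun x => bary V x ord0 i) [set y | 0 <= y]).
    by move=> x _; exact: continuous_bary.
  exact: closed_ge.
by apply/seteqP; split => x /= h i; [move=> _|]; exact: h.
Qed.

Lemma ocell_neq0 V : affinely_independent V -> ocell V !=set0.
Proof.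
move=> aV; pose l : 'rV[R]_n.+1 := const_mx (n.+1%:R^-1).
exists (l *m V) => i; rewrite baryK//; first by rewrite mxE.
under eq_bigr do rewrite mxE.
by rewrite sumr_const card_ord -[LHS]mulr_natl divff.
Qed.

(** A point of the cell outside [ocell V] lies in one of the finitely many null sets on which a
    barycentric coordinate vanishes. *)
Lemma ae_cell_ocell V : affinely_independent V ->
  {ae mu, forall x, cell V x -> ocell V x}.
Proof.
move=> aV.
have h (i : 'I_n.+1) : {ae mu, forall x, bary V x ord0 i != 0}.
  exists [set x : 'rV[R]_n | bary_cst V i + \sum_j x ord0 j * bary_lin V i j = 0]; split.
  - exact: measurable_aff_eq0.
  - by apply: lebesgue_rV_aff_eq0; exact: bary_neq0.
  - by move=> x /= /negP/negPn/eqP; rewrite baryE.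
have : {ae mu, forall x, forall i : 'I_n.+1, bary V x ord0 i != 0}.
  have := @ae_foralln _ _ _ mu (fun k x => bary V x ord0 (inord k) != 0) (fun k => h _).
  by apply: filterS => x hx i; have := hx i; rewrite inord_val.
by apply: filterS => x x0; rewrite cellE// => xV i; rewrite lt_def x0 xV.
Qed.

Lemma cell_bounded V : exists M : R, forall x, cell V x -> forall j, `|x ord0 j| < M.
Proof.
exists (1 + \sum_i \sum_j `|V i j|) => x [l [l0 _ l1 ->]] j.
apply: (@le_lt_trans _ _ (\sum_i \sum_j `|V i j|)); last by rewrite ltrDr.
rewrite mxE; apply: le_trans (ler_norm_sum _ _ _) _; apply: ler_sum => i _.
rewrite normrM; apply: (@le_trans _ _ `|V i j|).
  rewrite ler_piMl// ger0_norm// -l1 (bigD1 i)//= lerDl sumr_ge0//.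
by rewrite (bigD1 j)//= lerDl sumr_ge0.
Qed.

Lemma ocell_measure_lty V : affinely_independent V -> (mu (ocell V) < +oo)%E.
Proof.
move=> aV; have [M VM] := cell_bounded V.
apply: (bounded_rV_measure_lty (M := M)); first exact: (open_rV_measurable (@open_ocell V)).
by move=> x /(ocell_cell aV); exact: VM.
Qed.

Lemma ocell_measure_gt0 V : affinely_independent V -> (0 < mu (ocell V))%E.
Proof. by move=> aV; apply: open_rV_measure_gt0; [exact: open_ocell|exact: ocell_neq0]. Qed.

Lemma closed_cells G : (forall V, V \in G -> affinely_independent V) -> closed (cells G).
Proof.
move=> aG; rewrite (_ : cells G = \big[setU/set0]_(V <- G) cell V).
  rewrite big_seq; elim/big_ind: _ => [|A B|V VG]; [exact: closed0|exact: closedU|].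
  by apply: closed_cell; exact: aG.
by rewrite -bigcup_seq; apply/seteqP; split => x [V ? ?]; exists V.
Qed.

Section subdivision.
Variables (Om : set 'rV[R]_n) (G : seq 'M[R]_(n.+1, n)).
Hypotheses (pOm : polyhedral_domain Om) (sG : simplicial_subdivision Om G).

(** [Om] is the interior of a closed set, a finite union of simplices; an open subset of
    [closure Om] therefore lies in [Om]. *)
Lemma ocell_sub V : V \in G -> ocell V `<=` Om.
Proof.
case: pOm => oOm _ _ _ [P aP OmE]; case: sG => aG clOm _ VG.
rewrite OmE -open_subsetE; last exact: open_ocell.
apply: subset_trans (ocell_cell (aG _ VG)) _.
apply: (@subset_trans _ (closure Om)); first by rewrite clOm => x Vx; exists V.
rewrite [X in _ `<=` X](closure_id _).1; last exact: closed_cells.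
by apply: closureS; rewrite OmE; exact: interior_subset.
Qed.

Lemma ae_subdivision (Q : set 'rV[R]_n) :
  (forall V, V \in G -> {ae mu, forall x, cell V x -> Q x}) ->
  {ae mu, forall x, Om x -> Q x}.
Proof.
case: sG => aG clOm _ GQ.
have sub : Om `<=` cells G by rewrite -clOm; exact: subset_closure.
suff : {ae mu, forall x, cells G x -> Q x}.
  by apply: filterS => x h /sub; exact: h.
have h k : {ae mu, forall x, (k < size G)%N -> cell (nth 0 G k) x -> Q x}.
  have [kG|] := ltnP k (size G); last by move=> _; exact: aeW.
  by apply: filterS (GQ _ (mem_nth 0 kG)) => x h _.
have := @ae_foralln _ _ _ mu _ h.
apply: filterS => x hx [V VG Vx].
by apply: (hx (index V G)); rewrite ?index_mem// nth_index.
Qed.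

(** A point common to two open cells lies in no proper face of either, so the common face is the
    whole of both cells. The test is [cell V = cell W] and not [V = W] because one cell can be
    listed with its vertices permuted. *)
Lemma ae_indic_ocell V W : V \in G -> W \in G ->
  {ae mu, forall x, cell W x -> \1_(ocell V) x = `[< cell V = cell W >]%:R :> R}.
Proof.
case: sG => aG _ GI VG WG; have [aV aW] := (aG _ VG, aG _ WG).
have [VW|VW] := pselect (cell V = cell W).
  apply: filterS (ae_cell_ocell aV) => x xV xW.
  by rewrite indicE (asboolT VW) mem_set//; apply: xV; rewrite VW.
apply: filterS (ae_cell_ocell aW) => x xW /xW {}xW.
rewrite indicE (asboolF VW) memNset// => xV; apply: VW.
have [A [B [VA WB]]] := GI V W VG WG.
have xVW : (cell V `&` cell W) x by split; exact: ocell_cell.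
(* A vertex [i] outside [A] would force the barycentric coordinate [i] of [x] to be [0], whereas [x]
   is in the open cell. *)
have fullA : A = [set: 'I_n.+1]%SET.
  apply/setP => i; rewrite inE; apply/negP => /negP iA.
  by move: xVW; rewrite VA faceE// => -[_ /(_ _ iA) x0]; have := xV i; rewrite x0 ltxx.
have fullB : B = [set: 'I_n.+1]%SET.
  apply/setP => i; rewrite inE; apply/negP => /negP iA.
  by move: xVW; rewrite WB faceE// => -[_ /(_ _ iA) x0]; have := xW i; rewrite x0 ltxx.
by rewrite /cell -[in LHS]fullA -VA WB fullB.
Qed.

Lemma domain_measure_lty : (mu Om < +oo)%E.
Proof.
case: pOm => oOm _ _ [M [_ bOm]] _.
apply: (bounded_rV_measure_lty (M := `|M| + 2)); first exact: open_rV_measurable.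
move=> x /(bOm (`|M| + 1)); rewrite ltr_pwDr ?ler_norm//= => /(_ isT) xM i.
apply: (@le_lt_trans _ _ `|x|); last by rewrite (le_lt_trans xM)// ltrD2l ltr1n.
rewrite {2}/Num.norm /= mx_normrE.
exact: (le_bigmax _ (fun ij => `|x ij.1 ij.2|) (ord0, i)).
Qed.

End subdivision.

(** Open cells have positive measure. This turns an identity between constants that holds almost
    everywhere on a cell into a true identity. *)
Lemma ae_cell_inhab V (Q : set 'rV[R]_n) : affinely_independent V ->
  {ae mu, forall x, cell V x -> Q x} -> exists2 x, ocell V x & Q x.
Proof.
move=> aV [N [mN N0 sN]]; apply: contrapT => h.
have := ocell_measure_gt0 aV; rewrite lt_neqAle => /andP[/eqP + _]; apply; symmetry.
apply/eqP; rewrite -measure_le0 -N0; apply: le_measure; rewrite ?inE//.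
  exact: (open_rV_measurable (@open_ocell V)).
move=> x xV; apply: sN => /= /(_ (ocell_cell aV xV)) Qx.
by apply: h; exists x.
Qed.

Lemma aff_ae_eq0 V (c : R) (l : 'I_n -> R) : affinely_independent V ->
  {ae mu, forall x, cell V x -> c + \sum_i x ord0 i * l i = 0} ->
  c = 0 /\ forall i, l i = 0.
Proof.
move=> aV cl0; apply: contrapT => h.
have cl : c != 0 \/ exists i, l i != 0.
  have [c0|] := eqVneq c 0; last by left.
  right; apply: contrapT => /forallNP l0; apply: h; split => // i.
  by have /negP/negPn/eqP := l0 i.
have cl_neq0 : {ae mu, forall x : 'rV[R]_n, c + \sum_i x ord0 i * l i != 0}.
  exists [set x : 'rV[R]_n | c + \sum_i x ord0 i * l i = 0]; split.
  - exact: measurable_aff_eq0.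
  - exact: lebesgue_rV_aff_eq0.
  - by move=> x /= /negP/negPn/eqP.
suff : {ae mu, forall x, cell V x -> (set0 : set 'rV[R]_n) x}.
  by move=> /(ae_cell_inhab aV)[].
by apply: filterS2 cl0 cl_neq0 => x x0 /eqP xn0 xV; apply: xn0; exact: x0.
Qed.

End simplices.

(** * Square integrable forms and the weak codifferential *)

Section square_integrable.
Context d (T : measurableType d) (R : realType) (mu : {measure set T -> \bar R}).
Variables (D : set T) (mD : measurable D).
Implicit Types (f g : T -> R).

Definition sqint f := measurable_fun D f /\ mu.-integrable D (fun x => (f x ^+ 2)%:E).

Lemma sqintM f g : sqint f -> sqint g -> mu.-integrable D (fun x => (f x * g x)%:E).
Proof.
move=> [mf f2] [mg g2]; apply: (le_integrable mD _ _ (integrableD mD f2 g2)).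
  by apply/measurable_EFinP; exact: measurable_funM.
move=> x _; rewrite -EFinD !abse_EFin lee_fin.
rewrite normrM [leRHS]ger0_norm ?addr_ge0 ?sqr_ge0//.
rewrite -[f x ^+ 2]real_normK ?num_real// -[g x ^+ 2]real_normK ?num_real//.
have := sqr_ge0 (`|f x| - `|g x|); have := sqr_ge0 (`|f x| + `|g x|).
by nra.
Qed.

Lemma sqint_lin c f g : sqint f -> sqint g -> sqint (fun x => c * f x + g x).
Proof.
move=> qf qg; have [[mf f2] [mg g2]] := (qf, qg); split.
  by apply: measurable_funD => //; exact: measurable_funM.
rewrite (_ : (fun _ => _) = (fun x => (c ^+ 2 * f x ^+ 2)%:E +
    (((2 * c) * (f x * g x))%:E + (g x ^+ 2)%:E))%E); last first.
  by apply/funext => x; rewrite -!EFinD; congr EFin; ring.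
apply: integrableD => //; first exact: integrable_cstM.
by apply: integrableD => //; apply: integrable_cstM => //; exact: sqintM.
Qed.

Lemma sqint_bounded f M : (mu D < +oo)%E -> measurable_fun D f ->
  (forall x, D x -> `|f x| <= M) -> sqint f.
Proof.
move=> Doo mf fM; split => //.
apply: (@le_integrable _ _ _ mu D mD _ (fun=> (M ^+ 2)%:E)).
- by apply/measurable_EFinP; exact: measurable_funX.
- move=> x Dx; rewrite !abse_EFin lee_fin !normrX ler_pXn2r ?nnegrE//.
  by apply: le_trans (fM x Dx) _; exact: ler_norm.
- apply/integrableP; split; first exact: measurable_cst.
  by rewrite integral_cst//; apply: lte_mul_pinfty.
Qed.

Lemma sqint_cst c : (mu D < +oo)%E -> sqint (fun=> c).
Proof. by move=> Doo; exact: (@sqint_bounded _ `|c|). Qed.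

End square_integrable.

Section continuous_rV.
Context {R : realType} {n : nat}.
Local Notation mu := (lebesgue_rV R n).
Implicit Types (f g : 'rV[R]_n -> R).

Lemma continuous_rV_measurable f : continuous f -> measurable_fun setT f.
Proof.
move=> cf; apply: (measurability _ (RGenOInfty.measurableE R)) => _ [_ [c ->] <-].
rewrite setTI; apply: open_rV_measurable; exact: open_comp.
Qed.

Lemma compact_supp_bounded f K : continuous f -> compact K ->
  (forall x, ~ K x -> f x = 0) -> exists M, forall x, `|f x| <= M.
Proof.
move=> cf cK f0.
have := compact_bounded (continuous_compact (continuous_subspaceT cf) cK).
move=> [M [_ fM]]; exists (`|M| + 1) => x.
have [Kx|/f0 ->] := pselect (K x); last by rewrite normr0 addr_ge0.
by apply: fM; [rewrite ltr_pwDr// ler_norm|exists x].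
Qed.

Lemma iter_partial_lin s c f g : smooth f -> smooth g ->
  iter_partial s (fun x => c * f x + g x) =
  (fun x => c * iter_partial s f x + iter_partial s g x).
Proof.
move=> sf sg; elim: s => //= i s ->; apply/funext => x.
have [_ /(_ i x) df] := sf s; have [_ /(_ i x) dg] := sg s.
rewrite /partial deriveD//; last exact: (@derivableZ _ _ _ _ c).
by rewrite (deriveZ c df).
Qed.

Lemma smooth_lin c f g : smooth f -> smooth g -> smooth (fun x => c * f x + g x).
Proof.
move=> sf sg s; have [cf df] := sf s; have [cg dg] := sg s.
rewrite iter_partial_lin//; split.
  move=> x; apply: (@continuousD _ _ _ (fun x => c * _ x)); last exact: cg.
  by apply: continuousM; [exact: cst_continuous|exact: cf].
move=> i x; apply: derivableD; last exact: dg.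
by apply: (@derivableZ _ _ _ _ c); exact: df.
Qed.

Lemma smooth0 : smooth (fun=> 0 : R) (n := n).
Proof.
have h s : iter_partial s (fun=> 0 : R) = (fun=> 0) :> ('rV[R]_n -> R).
  by elim: s => //= i s ->; apply/funext => x; exact: derive_cst.
by move=> s; rewrite h; split => [|i x]; [exact: cst_continuous|exact: derivable_cst].
Qed.

End continuous_rV.

Section forms.
Context {R : realType} {n : nat}.
Local Notation mu := (lebesgue_rV R n).
Variable (Om : set 'rV[R]_n).
Hypotheses (oOm : open Om) (fOm : (mu Om < +oo)%E).
Implicit Types (w u v z : form R n) (k : nat) (c : R).

Let mOm : measurable Om := open_rV_measurable oOm.

(** This one operation carries the linear structure of all the spaces, in the shape that
    [double_annihilator] asks for. *)
Definition lin_form c w u : form R n :=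
  fun x => [ffun I : {set 'I_n} => c * w x I + u x I].

Local Notation sq w := (forall I : {set 'I_n}, sqint mu Om (fun x => w x I)).

Lemma kform_lin k c w u : kform k w -> kform k u -> kform k (lin_form c w u).
Proof. by move=> kw ku x I Ik; rewrite ffunE kw// ku// mulr0 addr0. Qed.

Lemma sq_lin c w u : sq w -> sq u -> sq (lin_form c w u).
Proof.
move=> qw qu I; rewrite (_ : (fun _ => _) = (fun x => c * w x I + u x I)).
  exact: sqint_lin.
by apply/funext => x; rewrite ffunE.
Qed.

Lemma L2form_lin k c w u : L2form Om k w -> L2form Om k u -> L2form Om k (lin_form c w u).
Proof. by move=> [kw qw] [ku qu]; split; [exact: kform_lin|exact: sq_lin]. Qed.

Lemma dotL2_lin c w u v : sq w -> sq u -> sq v ->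
  dotL2 Om (lin_form c w u) v = c * dotL2 Om w v + dotL2 Om u v.
Proof.
move=> qw qu qv; rewrite /dotL2 mulr_sumr -big_split /=; apply: eq_bigr => I _.
rewrite -RintegralZl//; last exact: sqintM.
rewrite -RintegralD//; last 2 first.
- by apply: integrable_cstM => //; exact: sqintM.
- exact: sqintM.
by apply: eq_Rintegral => x _; rewrite ffunE; ring.
Qed.

Lemma dotL2C w u : dotL2 Om w u = dotL2 Om u w.
Proof. by apply: eq_bigr => I _; apply: eq_Rintegral => x _; rewrite mulrC. Qed.

Lemma dotL2_linr c w u v : sq w -> sq u -> sq v ->
  dotL2 Om v (lin_form c w u) = c * dotL2 Om v w + dotL2 Om v u.
Proof. by move=> qw qu qv; rewrite dotL2C dotL2_lin// !(dotL2C v). Qed.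

Lemma dotL2_0l w : dotL2 Om (fun=> 0) w = 0.
Proof.
rewrite /dotL2 big1// => I _; rewrite (@eq_Rintegral _ _ _ _ _ (fun=> 0)).
  by rewrite Rintegral_cst// mul0r.
by move=> x _; rewrite ffunE mul0r.
Qed.

Lemma dotL2_0r w : dotL2 Om w (fun=> 0) = 0.
Proof. by rewrite dotL2C dotL2_0l. Qed.

Lemma dotL2_ae w w' u : sq w -> sq w' -> sq u ->
  {ae mu, forall x, Om x -> w x = w' x} -> dotL2 Om w u = dotL2 Om w' u.
Proof.
move=> qw qw' qu ww'; apply: eq_bigr => I _; congr fine; apply: ae_eq_integral => //.
- by have := sqintM mOm (qw I) (qu I) => /measurable_int.
- by have := sqintM mOm (qw' I) (qu I) => /measurable_int.
- by apply: filterS ww' => x h Ox; rewrite h.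
Qed.

Lemma dotL2_aer w w' u : sq w -> sq w' -> sq u ->
  {ae mu, forall x, Om x -> w x = w' x} -> dotL2 Om u w = dotL2 Om u w'.
Proof. by move=> qw qw' qu h; rewrite dotL2C (dotL2_ae qw qw' qu h) dotL2C. Qed.

Lemma dotL2_ge0 w : 0 <= dotL2 Om w w.
Proof.
by apply: sumr_ge0 => I _; apply: Rintegral_ge0 => x _; rewrite -expr2 sqr_ge0.
Qed.

Lemma normL2_sqr w : normL2 Om w ^+ 2 = dotL2 Om w w.
Proof. by rewrite /normL2 sqr_sqrtr// dotL2_ge0. Qed.

(** The parallelogram identity, from which the nonnegative square norm of [- c w + u] is dropped. *)
Lemma normL2_lin c w u : sq w -> sq u ->
  normL2 Om (lin_form c w u) ^+ 2 <= 2 * c ^+ 2 * normL2 Om w ^+ 2 + 2 * normL2 Om u ^+ 2.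
Proof.
move=> qw qu; rewrite !normL2_sqr.
have q1 := sq_lin c qw qu; have q2 := sq_lin (- c) qw qu.
have := dotL2_ge0 (lin_form (- c) w u).
by rewrite !(dotL2_lin, dotL2_linr)// (dotL2C u w); nra.
Qed.

Lemma sq_subr w u : sq w -> sq u -> sq (fun x => w x - u x).
Proof.
move=> qw qu I; rewrite (_ : (fun _ => _) = (fun x => - 1 * u x I + w x I)).
  exact: sqint_lin.
by apply/funext => x; rewrite !ffunE; ring.
Qed.

Lemma test_form_sq k v : test_form Om k v -> sq v.
Proof.
move=> [_ sv cK _] I; have [cv _] := sv I [::].
have [M vM] : exists M, forall x, `|v x I| <= M.
  apply: (compact_supp_bounded cv cK) => x Kx.
  have [v0|v0] := eqVneq (v x) 0; first by rewrite /= v0 ffunE.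
  by exfalso; apply: Kx; exact: subset_closure.
apply: (@sqint_bounded _ _ _ _ _ _ _ M) => //.
apply: measurable_funTS; exact: (continuous_rV_measurable cv).
Qed.

Lemma test_form_extd_sq k v : test_form Om k v -> sq (extd v).
Proof.
move=> [_ sv cK _] I.
have dE : (fun x => extd v x I) = (fun x => \sum_(i in I) sgn_ins R i I *
    partial i (fun y => v y (I :\ i)%SET) x).
  by apply/funext => x; rewrite ffunE.
rewrite dE.
suff h i : sqint mu Om (partial i (fun y => v y (I :\ i)%SET)).
  elim: (index_enum _) => [|i r IH].
    under eq_fun do rewrite big_nil; exact: sqint_cst.
  under eq_fun do rewrite big_cons.
  by case: (i \in I) => //; exact: sqint_lin.
have [cv _] := sv (I :\ i)%SET [:: i].
have [M vM] : exists M, forall x, `|partial i (fun y => v y (I :\ i)%SET) x| <= M.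
  apply: (compact_supp_bounded cv cK) => x Kx.
  change (partial i (fun y => v y (I :\ i)%SET) x = 0).
  rewrite /partial (near_eq_derive (g := cst 0)) ?derive_cst//.
  have : nbhs x (~` closure [set x | v x != 0]).
    by apply: open_nbhs_nbhs; split => //; apply: closed_openC; exact: closed_closure.
  apply: filterS => y Ky; have [v0|v0] := eqVneq (v y) 0; first by rewrite /= v0 ffunE.
  by exfalso; apply: Ky; exact: subset_closure.
apply: (@sqint_bounded _ _ _ _ _ _ _ M) => //.
apply: measurable_funTS; exact: (continuous_rV_measurable cv).
Qed.

Lemma test_form_lin k c v z : test_form Om k v -> test_form Om k z ->
  test_form Om k (lin_form c v z).
Proof.
move=> [kv sv cv Kv] [kz sz cz Kz].
have sub : closure [set x | lin_form c v z x != 0] `<=`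
    closure [set x | v x != 0] `|` closure [set x | z x != 0].
  rewrite -closureU; apply: closureS => x /= h.
  apply/orP; rewrite -negb_and; apply: contra h => /andP[/eqP v0 /eqP z0].
  by apply/eqP/ffunP => I; rewrite !ffunE v0 z0 !ffunE mulr0 addr0.
split.
- exact: kform_lin.
- move=> I; rewrite (_ : (fun _ => _) = (fun x => c * v x I + z x I)).
    exact: smooth_lin.
  by apply/funext => x; rewrite ffunE.
- by apply: (subclosed_compact _ _ sub); [exact: closed_closure|exact: compactU].
- by apply: (subset_trans sub) => x [/Kv|/Kz].
Qed.

Lemma test_form0 k : test_form Om k (fun=> 0).
Proof.
have e : closure [set x : 'rV[R]_n | ((fun=> 0) : form R n) x != 0] = set0.
  by rewrite -[RHS]closure0; congr closure; apply/seteqP; split => // x /=; rewrite eqxx.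
split.
- by move=> x I _; rewrite ffunE.
- move=> I; rewrite (_ : (fun _ => _) = (fun=> 0)); first exact: smooth0.
  by apply/funext => x; rewrite ffunE.
- by rewrite e; exact: compact0.
- by rewrite e; exact: sub0set.
Qed.

Lemma codiff_lin k c w1 u1 w2 u2 : codiff Om k w1 u1 -> codiff Om k w2 u2 ->
  codiff Om k (lin_form c w1 w2) (lin_form c u1 u2).
Proof.
move=> [Lw1 Lu1 h1] [Lw2 Lu2 h2]; split; [exact: L2form_lin|exact: L2form_lin|].
move=> v tv; rewrite !dotL2_linr ?h1 ?h2//; try by [case: Lw1|case: Lw2|case: Lu1|case: Lu2].
- exact: test_form_sq tv.
- exact: test_form_extd_sq tv.
Qed.

Lemma codiff_ae k w u w' u' : L2form Om k w' -> L2form Om k.-1 u' ->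
  {ae mu, forall x, Om x -> w x = w' x} ->
  {ae mu, forall x, Om x -> u x = u' x} ->
  codiff Om k w u -> codiff Om k w' u'.
Proof.
move=> Lw' Lu' ww' uu' [Lw Lu h]; split => // v tv.
have [[_ qw'] [_ qu'] [_ qw] [_ qu]] := And4 Lw' Lu' Lw Lu.
rewrite -(dotL2_aer qw qw' _ ww'); last exact: test_form_extd_sq tv.
by rewrite -(dotL2_aer qu qu' _ uu') ?h//; exact: test_form_sq tv.
Qed.

Lemma L2form0 k : L2form Om k (fun=> 0).
Proof.
split=> [x I _|I]; first by rewrite ffunE.
change (sqint mu Om (fun _ => (0 : covector R n) I)).
rewrite (_ : (fun _ => _) = (fun=> 0)); first exact: sqint_cst.
by apply/funext => x; rewrite ffunE.
Qed.

Lemma codiff0 k : codiff Om k (fun=> 0) (fun=> 0).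
Proof.
by split; [exact: L2form0|exact: L2form0|move=> v _; rewrite !dotL2_0r].
Qed.

Lemma Hstar_lin k c w1 w2 : Hstar Om k w1 -> Hstar Om k w2 -> Hstar Om k (lin_form c w1 w2).
Proof.
by move=> [u1 h1] [u2 h2]; exists (lin_form c u1 u2); exact: codiff_lin.
Qed.

Lemma Hstar0_lin k c w1 w2 : Hstar0 Om k w1 -> Hstar0 Om k w2 ->
  Hstar0 Om k (lin_form c w1 w2).
Proof.
move=> [u1 h1 a1] [u2 h2 a2].
exists (lin_form c u1 u2) => [|e e0]; first exact: codiff_lin.
(* With errors below [e / (2 * (|c| + 1))] for [w1] and [e / 2] for [w2], the squared error of the
   combination is at most [2 * c ^+ 2 * A1 + 2 * A2], hence below [4 * (e / 2) ^+ 2]. The [+ 1]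
   takes care of [c = 0]. *)
have e1 : 0 < e / (2 * (`|c| + 1)) by rewrite divr_gt0// mulr_gt0// ltr_wpDl.
have [v1 [z1 [tv1 cv1 n1]]] := a1 _ e1.
have [v2 [z2 [tv2 cv2 n2]]] := a2 _ (divr_gt0 e0 (ltr0n _ 2 : 0 < 2)).
exists (lin_form c v1 v2), (lin_form c z1 z2).
split; [exact: test_form_lin|exact: codiff_lin|].
have linB f1 f2 g1 g2 : (fun x => lin_form c f1 f2 x - lin_form c g1 g2 x) =
    lin_form c (fun x => f1 x - g1 x) (fun x => f2 x - g2 x).
  by apply/funext => x; apply/ffunP => I; rewrite !ffunE; ring.
rewrite !linB.
have [[_ qw1] [_ qu1] _] := h1; have [[_ qw2] [_ qu2] _] := h2.
have [[_ qv1] [_ qz1] _] := cv1; have [[_ qv2] [_ qz2] _] := cv2.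
have i1 := normL2_lin c (sq_subr qw1 qv1) (sq_subr qw2 qv2).
have i2 := normL2_lin c (sq_subr qu1 qz1) (sq_subr qu2 qz2).
have sqr_lt (s t : R) : 0 <= s -> 0 < t -> Num.sqrt s < t -> s < t ^+ 2.
  move=> s0 t0; rewrite -{2}(sqr_sqrtr s0) => st.
  by rewrite ltr_pXn2r// ?nnegrE ?sqrtr_ge0 ?ltW.
set A1 := normL2 _ _ ^+ 2 + _ in n1; set A2 := normL2 _ _ ^+ 2 + _ in n2.
have A1ge : 0 <= A1 by rewrite addr_ge0// sqr_ge0.
have A2ge : 0 <= A2 by rewrite addr_ge0// sqr_ge0.
have l1 := sqr_lt _ _ A1ge e1 n1.
have l2 := sqr_lt _ _ A2ge (divr_gt0 e0 (ltr0n _ 2 : 0 < 2)) n2.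
rewrite -[ltRHS](gtr0_norm e0) -sqrtr_sqr ltr_sqrt; last by rewrite exprn_gt0.
apply: le_lt_trans (lerD i1 i2) _.
have regroup (r x y x' y' : R) :
    2 * r * x + 2 * y + (2 * r * x' + 2 * y') = 2 * (r * (x + x')) + 2 * (y + y') by ring.
rewrite regroup -/A1 -/A2.
have c1 : c ^+ 2 * (e / (2 * (`|c| + 1))) ^+ 2 <= (e / 2) ^+ 2.
  have t0 : `|c| + 1 != 0 by rewrite gt_eqF// ltr_wpDl.
  have -> : e / 2 = (`|c| + 1) * (e / (2 * (`|c| + 1))) by field.
  rewrite -[c ^+ 2]real_normK ?num_real// [leRHS]exprMn; apply: ler_wpM2r; first exact: sqr_ge0.
  by apply: lerXn2r; rewrite ?nnegrE ?addr_ge0// lerDl.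
have c2 : c ^+ 2 * A1 <= (e / 2) ^+ 2.
  by apply: le_trans c1; apply: ler_wpM2l; [exact: sqr_ge0|exact: ltW].
have -> : e ^+ 2 = 4 * (e / 2) ^+ 2 by field.
suff sum_lt (x y z : R) : y < z -> x <= z -> 2 * x + 2 * y < 4 * z by exact: sum_lt l2 c2.
by lra.
Qed.

End forms.

(** * Forms [f dx^I] as test forms, and the codifferential inside a cell *)

Section single_component_forms.
Context {R : realType} {n : nat}.
Local Notation mu := (lebesgue_rV R n).
Implicit Types (I J : {set 'I_n}) (f : 'rV[R]_n -> R) (w u : form R n)
  (Om U : set 'rV[R]_n).

Definition single_form I f : form R n :=
  fun x => [ffun J : {set 'I_n} => if J == I then f x else 0].

Lemma dotL2_single Om I f u :
  dotL2 Om (single_form I f) u = \int[mu]_(x in Om) (f x * u x I).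
Proof.
rewrite /dotL2 (bigD1 I)//= big1 ?addr0 => [|J JI].
  by apply: eq_Rintegral => x _; rewrite ffunE eqxx.
rewrite (@eq_Rintegral _ _ _ _ _ (fun=> 0)) => [|x _].
  by rewrite /Rintegral integral0.
by rewrite ffunE (negbTE JI) mul0r.
Qed.

Lemma extd_single_U1 I f x i : i \notin I ->
  extd (single_form I f) x (i |: I) = sgn_ins R i I * partial i f x.
Proof.
move=> iI; rewrite ffunE (bigD1 i) ?finset.setU11//= big1 ?addr0 => [|j /andP[jI ji]].
  rewrite sgn_ins_U1; congr (_ * partial _ _ _); apply/funext => y.
  by rewrite ffunE finset.setU1K// eqxx.
rewrite (_ : (fun y => _) = cst 0) ?[partial _ _ _]derive_cst ?mulr0//.
apply/funext => y; rewrite ffunE; case: eqP => // /setP/(_ i).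
by rewrite !inE eqxx eq_sym ji (negbTE iI).
Qed.

Lemma extd_single_eq0 I f x J : J \notin [set i |: I | i in ~: I]%SET ->
  extd (single_form I f) x J = 0.
Proof.
move=> JI; rewrite ffunE big1// => i iJ.
rewrite (_ : (fun y => _) = cst 0) ?[partial _ _ _]derive_cst ?mulr0//.
apply/funext => y; rewrite ffunE; case: eqP => // JiI; case/negP: JI.
by apply/imsetP; exists i; rewrite -JiI ?finset.setD1K// !inE eqxx.
Qed.

(** The differential of [f dx^I] has components only on the sets [i |: I] with [i \notin I]; [i] is
    recovered from such a set, so the sum can be indexed by [i]. *)
Lemma dotL2_extd_single Om I f w : dotL2 Om (extd (single_form I f)) w =
  \sum_(i | i \notin I) \int[mu]_(x in Om)
     (partial i f x * (sgn_ins R i I * w x (i |: I))).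
Proof.
rewrite /dotL2 (bigID (mem [set i |: I | i in ~: I]%SET)) /= [X in _ + X]big1 ?addr0.
  rewrite big_imset /=.
    apply: eq_big => [i|i iI]; first by rewrite inE.
    rewrite inE in iI; apply: eq_Rintegral => x _.
    by rewrite extd_single_U1// -mulrA mulrCA.
  move=> i j; rewrite !inE => iI jI /setP/(_ i); rewrite !inE eqxx (negbTE iI) !orbF.
  by move=> /esym/eqP.
move=> J JI; rewrite (@eq_Rintegral _ _ _ _ _ (fun=> 0)) => [|x _].
  by rewrite /Rintegral integral0.
by rewrite extd_single_eq0// mul0r.
Qed.

Lemma test_form_box_bump Om I a b m : cbox a b `<=` Om ->
  test_form Om #|I| (single_form I (box_bump a b m)).
Proof.
move=> abOm; have sub : closure [set x | single_form I (box_bump a b m) x != 0] `<=` cbox a b.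
  rewrite [X in _ `<=` X](closure_id _).1; last exact: closed_cbox.
  apply: closureS => x /= h; apply: obox_sub_cbox; apply: contrapT => /box_bump_out x0.
  case/eqP: h; apply/ffunP => J; rewrite !ffunE.
  by case: eqP => // _; exact: x0.
split.
- by move=> x J JI; rewrite ffunE; case: (J =P I) JI => // ->; rewrite eqxx.
- move=> J; rewrite (_ : (fun _ => _) = (if J == I then box_bump a b m else (fun=> 0))).
    by case: eqP => _; [exact: smooth_box_bump|exact: smooth0].
  by apply/funext => x; rewrite ffunE; case: eqP.
- by apply: (subclosed_compact _ (@compact_cbox _ _ a b) sub); exact: closed_closure.
- exact: subset_trans sub abOm.
Qed.

Lemma Rintegral_supp (Om U : set 'rV[R]_n) f : U `<=` Om -> (forall x, ~ U x -> f x = 0) ->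
  \int[mu]_(x in Om) f x = \int[mu]_(x in U) f x.
Proof.
move=> UOm f0; rewrite -(setIidr UOm) Rintegral_mkcondr; apply: eq_Rintegral => x _.
by rewrite patchE; case: ifPn => // /negP; rewrite inE => /f0.
Qed.

(* Inside a cell the weak codifferential is the classical one: test forms are
   [box_bump dx^I], and the fundamental lemma removes them. *)
Lemma codiff_cell Om U w u (a b : covector R n) k : open Om -> open U -> U `<=` Om ->
  (mu Om < +oo)%E -> codiff Om k.+1 w u ->
  {ae mu, forall x, U x -> w x = hodge (a + koszul x b)} ->
  forall I, #|I| = k -> {ae mu, forall x, U x -> u x I = whitney_star_codiff b I}.
Proof.
move=> oOm oU UOm fOm [[_ qw] [_ qu] wu] wab I Ik.
have mOm := open_rV_measurable oOm; have mU := open_rV_measurable oU.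
have fU : (mu U < +oo)%E by apply: le_lt_trans fOm; apply: le_measure; rewrite ?inE.
set c := whitney_star_codiff b I.
have iu : mu.-integrable U (fun x => (u x I)%:E).
  apply: (integrableS mOm mU UOm).
  have := sqintM mOm (qu I) (sqint_cst mOm 1 fOm).
  by under eq_fun do rewrite mulr1.
have ic : mu.-integrable U (fun=> c%:E).
  have := sqintM mU (sqint_cst mU c fU) (sqint_cst mU 1 fU).
  by under eq_fun do rewrite mulr1.
have ig : mu.-integrable U (EFin \o (fun x => u x I - c)) by exact: (integrableB mU iu ic).
suff : {ae mu, forall x, U x -> u x I - c = 0}.
  by apply: filterS => x h /h /eqP; rewrite subr_eq0 => /eqP.
apply: (fundamental_lemma oU ig) => p q m pq pqU.
set f := box_bump p q m.
have f0 x : ~ U x -> f x = 0.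
  by move=> Ux; apply: box_bump_out => /obox_sub_cbox /pqU.
have df0 i x : ~ U x -> partial i f x = 0.
  by move=> Ux; apply: partial_box_bump_out => /pqU.
have tf : test_form Om k.+1.-1 (single_form I f).
  by rewrite /= -Ik; apply: test_form_box_bump; exact: subset_trans pqU UOm.
have mf : measurable_fun U f by apply: measurable_funTS; exact: measurable_box_bump.
have intf : mu.-integrable U (EFin \o f).
  by apply: integrableS (integrable_box_bump p q m).
have := wu _ tf; rewrite dotL2_single dotL2_extd_single.
rewrite (Rintegral_supp UOm); last by move=> x /f0 ->; rewrite mul0r.
(* Each term is integrated by parts: of the affine component [i |: I] of [w] only the slope in
   direction [i] is left, and these signed slopes add up to [c]. *)
rewrite (eq_bigr (fun i => - (sgn_ins R i I * whitney_star_lin b (i |: I) i) *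
    \int[mu]_(x in U) f x)) => [|i iI]; last first.
  rewrite (Rintegral_supp UOm); last by move=> x /df0 ->; rewrite mul0r.
  pose l j := sgn_ins R i I * whitney_star_lin b (i |: I) j.
  pose d := sgn_ins R i I * whitney_star_cst a (i |: I).
  have [iaff affE] := integral_partial_box_bump i m d l pq.
  transitivity (\int[mu]_(x in U) (partial i f x * (d + \sum_j x ord0 j * l j))).
    congr fine; apply: ae_eq_integral => //.
    - apply/measurable_EFinP; apply: measurable_funM.
        by apply: measurable_funTS; exact: measurable_partial_box_bump.
      apply: measurable_funM => //.
      by apply: measurable_funS UOm _ => //; have [] := qw (i |: I).
    - by apply: measurable_funTS; exact: measurable_int iaff.
    apply: filterS wab => x h Ux; rewrite (h Ux) hodge_whitneyE /d /l mulrDr mulr_sumr.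
    by congr ((_ * (_ + _))%:E); apply: eq_bigr => j _; ring.
  (* Integration by parts is stated on the whole space; the bump and its derivatives vanish outside
     [U], so the integrals can be extended. *)
  rewrite -(Rintegral_supp (subsetT U)); last by move=> x /df0 ->; rewrite mul0r.
  by rewrite affE (Rintegral_supp (subsetT U)).
rewrite -mulr_suml sumrN.
have -> : - (\sum_(i | i \notin I) sgn_ins R i I * whitney_star_lin b (i |: I) i) = c.
  by rewrite /c ffunE.
have ifu : mu.-integrable U (EFin \o (fun x => f x * u x I)).
  apply: le_integrable iu => //.
    apply/measurable_EFinP; apply: measurable_funM => //.
    by apply: measurable_funS UOm _ => //; have [] := qu I.
  move=> x _; rewrite lee_fin normrM; have /andP[? ?] := box_bump_itv p q m x.
  by rewrite ger0_norm// ler_piMl.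
move=> cfu; under eq_Rintegral do rewrite mulrBr.
rewrite RintegralB//; last first.
  rewrite (_ : EFin \o _ = (fun x => (c * f x)%:E)); first exact: integrable_cstM.
  by apply/funext => x /=; rewrite mulrC.
by rewrite RintegralZr// -cfu mulrC subrr.
Qed.

End single_component_forms.

(** * Duality between the two families of spaces *)

Section finite_dimensional_duality.
Context {F : fieldType}.

(** A subspace given as a mere predicate is the row space of a matrix of maximal rank among those
    with rows in it; the columns of its [cokermx] then provide enough vectors [m]. *)
Lemma row_double_annihilator N (C : set 'rV[F]_N) :
  C 0 -> (forall a u v, C u -> C v -> C (a *: u + v)) ->
  forall c0, (forall m : 'cV[F]_N, (forall c, C c -> c *m m = 0) -> c0 *m m = 0) -> C c0.
Proof.
move=> C0 CD c0 hc0.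
have CM M (A : 'M[F]_(M, N)) : (forall i, C (row i A)) -> forall r, (r <= A)%MS -> C r.
  move=> CA r /submxP[u ->]; rewrite mulmx_sum_row.
  by elim: (index_enum _) => [|i s IH]; rewrite ?big_nil// big_cons; exact: CD.
pose P r := `[< exists2 A : 'M[F]_N, (forall i, C (row i A)) & \rank A = r >].
have exP : exists r, P r.
  exists 0%N; apply/asboolP; exists 0; last exact: mxrank0.
  by move=> i; rewrite row0.
have leP r : P r -> (r <= N)%N by move=> /asboolP[A _ <-]; exact: rank_leq_row.
case: (ex_maxnP exP leP) => r /asboolP[A CA <-] rmax.
(* Otherwise adjoining [c] to [A] would raise the rank while keeping the rows in [C]. *)
have CsubA c : C c -> (c <= A)%MS.
  move=> Cc; apply: contraT => cA.
  have Cadd i : C (row i (A + c)%MS).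
    apply: (CM _ (col_mx A c)); last by rewrite (submx_trans (row_sub _ _)) ?addsmxE.
    move=> j; case: (split_ordP j) => l ->; first by rewrite rowKu.
    by rewrite rowKd (ord1 l) row_id.
  have := rmax (\rank (A + c)%MS) (asboolT (ex_intro2 _ _ _ Cadd erefl)).
  rewrite leqNgt => /negP[]; rewrite ltnNge; apply/negP => rAc.
  have := mxrank_leqif_sup (addsmxSl A c) => -[_ E].
  have : (A + c <= A)%MS by rewrite -E eqn_leq rAc mxrankS// addsmxSl.
  by rewrite addsmx_sub (negbTE cA) andbF.
apply: (CM _ A CA); rewrite submxE; apply/eqP/matrixP => i j; rewrite ord1 [RHS]mxE.
have /matrixP/(_ ord0 ord0) : c0 *m col j (cokermx A) = 0.
  apply: hc0 => c /CsubA; rewrite submxE => /eqP cA.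
  by rewrite colE mulmxA cA mul0mx.
by rewrite colE mulmxA -colE !mxE => ->.
Qed.

(** Used with [T] indexing a spanning family and functionals recorded by their values on it. These
    values may satisfy linear relations, so the family need not be free. *)
Lemma double_annihilator (T : finType) (C : set (T -> F)) :
  C (fun=> 0) -> (forall a f g, C f -> C g -> C (fun t => a * f t + g t)) ->
  forall c0, (forall m : T -> F, (forall c, C c -> \sum_t m t * c t = 0) ->
    \sum_t m t * c0 t = 0) -> C c0.
Proof.
move=> C0 CD c0 hc0.
pose toT (r : 'rV[F]_#|T|) : T -> F := fun t => r ord0 (enum_rank t).
pose toR (c : T -> F) : 'rV[F]_#|T| := \row_i c (enum_val i).
have toRK : cancel toR toT.
  by move=> c; apply/funext => t; rewrite /toT mxE enum_rankK.
rewrite -(toRK c0).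
apply: (@row_double_annihilator _ [set r | C (toT r)]) => /=.
- by rewrite (_ : toT 0 = fun=> 0)//; apply/funext => t; rewrite /toT mxE.
- move=> a u v Cu Cv; rewrite (_ : toT _ = fun t => a * toT u t + toT v t); first exact: CD.
  by apply/funext => t; rewrite /toT !mxE.
have mulE (r : 'rV[F]_#|T|) (m : 'cV[F]_#|T|) :
    (r *m m) ord0 ord0 = \sum_t m (enum_rank t) ord0 * toT r t.
  rewrite mxE (reindex_onto enum_rank enum_val) => [|i _]; last exact: enum_valK.
  by apply: eq_big => [t|t _]; [rewrite enum_rankK eqxx|rewrite mulrC].
move=> m hm; apply/matrixP => i j; rewrite !ord1 [RHS]mxE mulE toRK.
apply: hc0 => c Cc; rewrite -(toRK c) -mulE hm ?mxE//=.
by rewrite toRK.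
Qed.

End finite_dimensional_duality.

(** * A finite spanning family of piecewise Whitney forms and its cellwise derivatives *)

Section cellwise_forms.
Context {R : realType} {n : nat}.
Local Notation mu := (lebesgue_rV R n).
Implicit Types (I J : {set 'I_n}) (V W : 'M[R]_(n.+1, n)) (w u : form R n)
  (a b : covector R n).

Lemma whitneyE a b (x : 'rV[R]_n) J :
  (a + koszul x b) J = a J + \sum_i x ord0 i * koszul_coef b J i.
Proof. by rewrite ffunE koszulE. Qed.

Lemma whitney_ae_eq V k (p q : form R n) : affinely_independent V ->
  whitney k p -> whitney k q -> p = q %[ae mu in cell V] -> p = q.
Proof.
move=> aV [a [b [_ _ ->]]] [a' [b' [_ _ ->]]] pq.
have h J : (a J - a' J = 0) /\ forall i, koszul_coef b J i - koszul_coef b' J i = 0.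
  apply: (aff_ae_eq0 aV); apply: filterS pq => x + xV => /(_ xV) /ffunP/(_ J).
  rewrite !whitneyE => /eqP; rewrite -subr_eq0 opprD addrACA -sumrB => /eqP E.
  rewrite -{}[RHS]E; congr (_ + _); apply: eq_bigr => i _; by rewrite mulrBr.
apply/funext => x; apply/ffunP => J; rewrite !whitneyE.
have [/eqP + l] := h J; rewrite subr_eq0 => /eqP ->; congr (_ + _).
by apply: eq_bigr => i _; congr (_ * _); apply/eqP; rewrite -subr_eq0 l.
Qed.

Lemma whitney_cst k a : kcovector k a -> whitney (n := n) k (fun=> a).
Proof.
move=> ka; exists a, 0; split => //; first by move=> J _; rewrite ffunE.
by apply/funext => x; rewrite koszul0 addr0.
Qed.

Lemma extd_cst a : extd (fun=> a) = (fun=> 0) :> form R n.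
Proof.
apply/funext => x; apply/ffunP => J; rewrite !ffunE big1// => i _.
by rewrite [partial _ _ _]derive_cst mulr0.
Qed.

(* A spanning family of the piecewise Whitney [k]-forms: on each cell the forms
   [dx^I] (flag [false]) and [koszul x dx^I] (flag [true]), and [0] when [I] has
   the wrong cardinality.  It need not be free: [G] may list one cell several
   times, with permuted vertices. *)
Section spanning_forms.
Variables (G : seq 'M[R]_(n.+1, n)) (k : nat).

Definition span_index : finType := ('I_(size G) * {set 'I_n} * bool)%type.
Implicit Types (t : span_index) (m : span_index -> R).

Definition span_cell t : 'M[R]_(n.+1, n) := nth 0 G t.1.1.

Definition dx I : covector R n := [ffun J : {set 'I_n} => (J == I)%:R].

Definition span_cst t : covector R n :=
  if ~~ t.2 && (#|t.1.2| == k) then dx t.1.2 else 0.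
Definition span_lin t : covector R n :=
  if t.2 && (#|t.1.2| == k.+1) then dx t.1.2 else 0.

(** The open cell is taken for the cut-off because it is contained in [Om]; it misses only a null
    set of the cell. *)
Definition span_form t : form R n := fun x =>
  [ffun J : {set 'I_n} => \1_(ocell (span_cell t)) x * (span_cst t + koszul x (span_lin t)) J].
Definition span_dform t : form R n := fun x =>
  [ffun J : {set 'I_n} => \1_(ocell (span_cell t)) x * (k.+1%:R * span_lin t J)].

Lemma kcovector_dx I : kcovector #|I| (dx I).
Proof. by move=> J JI; rewrite ffunE; case: (J =P I) JI => // ->; rewrite eqxx. Qed.

Lemma kcovector_span_cst t : kcovector k (span_cst t).
Proof.
rewrite /span_cst; case: ifP => [/andP[_ /eqP <-]|_]; first exact: kcovector_dx.
by move=> J _; rewrite ffunE.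
Qed.

Lemma kcovector_span_lin t : kcovector k.+1 (span_lin t).
Proof.
rewrite /span_lin; case: ifP => [/andP[_ /eqP <-]|_]; first exact: kcovector_dx.
by move=> J _; rewrite ffunE.
Qed.

Definition comb (F : span_index -> form R n) m : form R n :=
  fun x => [ffun J : {set 'I_n} => \sum_t m t * F t x J].

Variable Om : set 'rV[R]_n.
Hypotheses (pOm : polyhedral_domain Om) (sG : simplicial_subdivision Om G).

Let oOm : open Om. Proof. by case: pOm. Qed.
Let fOm : (mu Om < +oo)%E := domain_measure_lty pOm.
Let mOm : measurable Om := open_rV_measurable oOm.

Lemma span_cell_in t : span_cell t \in G.
Proof. exact: mem_nth. Qed.

Let aff_cell t : affinely_independent (span_cell t).
Proof. by case: sG => aG _ _; apply: aG; exact: span_cell_in. Qed.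

Local Notation sq w := (forall J : {set 'I_n}, sqint mu Om (fun x => w x J)).

Lemma span_form_sq t : sq (span_form t).
Proof.
move=> J; set V := span_cell t; have [M VM] := cell_bounded V.
rewrite (_ : (fun _ => _) = (fun x => \1_(ocell V) x * (span_cst t J +
    \sum_i x ord0 i * koszul_coef (span_lin t) J i))); last first.
  by apply/funext => x; rewrite ffunE whitneyE.
apply: (@sqint_bounded _ _ _ _ _ _ _
    (`|span_cst t J| + \sum_i M * `|koszul_coef (span_lin t) J i|)) => //.
  apply: measurable_funTS; apply: measurable_funM; last exact: measurable_aff.
  by apply: measurable_indic; exact: (open_rV_measurable (@open_ocell _ _ V)).
move=> x Ox; rewrite indicE; case: (boolP (x \in ocell V)) => [|_] /=; rewrite ?mul0r ?mul1r.
  rewrite inE => /(ocell_cell (@aff_cell t))/VM xM.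
  apply: le_trans (ler_normD _ _) _; rewrite lerD2l.
  apply: le_trans (ler_norm_sum _ _ _) _; apply: ler_sum => i _.
  by rewrite normrM ler_wpM2r// ltW.
have [y yV] := ocell_neq0 (@aff_cell t).
rewrite normr0 addr_ge0// sumr_ge0// => i _; rewrite mulr_ge0//.
by apply: le_trans (ltW (VM y (ocell_cell (@aff_cell t) yV) i)).
Qed.

Lemma span_dform_sq t : sq (span_dform t).
Proof.
move=> J; set V := span_cell t.
rewrite (_ : (fun _ => _) = (fun x => (k.+1%:R * span_lin t J) * \1_(ocell V) x + 0)).
  apply: sqint_lin => //; last exact: sqint_cst.
  apply: (@sqint_bounded _ _ _ _ _ _ _ 1) => //.
    by apply: measurable_indic; exact: (open_rV_measurable (@open_ocell _ _ V)).
  by move=> x _; rewrite indicE; case: (x \in ocell V); rewrite ?normr0 ?normr1.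
by apply/funext => x; rewrite ffunE addr0 mulrC.
Qed.

Lemma comb_sq (F : span_index -> form R n) m : (forall t, sq (F t)) -> sq (comb F m).
Proof.
move=> qF J; rewrite (_ : (fun _ => _) = (fun x => \sum_t m t * F t x J)).
  elim: (index_enum _) => [|t r IH].
    by under eq_fun do rewrite big_nil; exact: sqint_cst.
  by under eq_fun do rewrite big_cons; exact: sqint_lin.
by apply/funext => x; rewrite ffunE.
Qed.

Lemma dotL2_comb (F : span_index -> form R n) m u : (forall t, sq (F t)) -> sq u ->
  dotL2 Om (comb F m) u = \sum_t m t * dotL2 Om (F t) u.
Proof.
move=> qF qu; rewrite /comb.
(* Square integrability of the partial sums is carried along, since linearity of [dotL2] requires it
   at each step. *)
suff h r : (forall J : {set 'I_n}, sqint mu Om (fun x => \sum_(t <- r) m t * F t x J)) /\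
    dotL2 Om (fun x => [ffun J : {set 'I_n} => \sum_(t <- r) m t * F t x J]) u =
    \sum_(t <- r) m t * dotL2 Om (F t) u.
  by have [] := h (index_enum span_index).
elim: r => [|t r [IHq IH]].
  split => [J|]; first by under eq_fun do rewrite big_nil; exact: sqint_cst.
  rewrite big_nil (_ : (fun _ => _) = (fun=> 0)) ?dotL2_0l//.
  by apply/funext => x; apply/ffunP => J; rewrite !ffunE big_nil.
split => [J|]; first by under eq_fun do rewrite big_cons; exact: sqint_lin.
rewrite big_cons -IH -dotL2_lin//.
  congr dotL2; apply/funext => x; apply/ffunP => J.
  by rewrite !ffunE big_cons.
move=> J; rewrite (_ : (fun _ => _) = (fun x => \sum_(t <- r) m t * F t x J))//.
by apply/funext => x; rewrite ffunE.
Qed.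

Lemma dotL2_indic_cst V (c : covector R n) u : V \in G -> sq u ->
  dotL2 Om (fun x => [ffun J : {set 'I_n} => \1_(ocell V) x * c J]) u =
  \sum_J c J * \int[mu]_(x in ocell V) u x J.
Proof.
move=> VG qu; apply: eq_bigr => J _.
have VOm := ocell_sub pOm sG VG.
have mV := open_rV_measurable (@open_ocell _ _ V).
rewrite -RintegralZl//; last first.
  apply: (integrableS mOm mV VOm).
  have := sqintM mOm (qu J) (sqint_cst mOm 1 fOm).
  by under eq_fun do rewrite mulr1.
rewrite (Rintegral_supp VOm) => [|x Vx].
  by apply: eq_Rintegral => x xV; rewrite ffunE indicE xV mul1r.
by rewrite ffunE indicE memNset// !mul0r.
Qed.

(** All indices whose cell equals [W] as a set contribute, which accounts for repeated listings of a
    cell. *)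
Definition comb_cst m W : covector R n :=
  [ffun J : {set 'I_n} => \sum_t m t * (`[< cell (span_cell t) = cell W >]%:R * span_cst t J)].
Definition comb_lin m W : covector R n :=
  [ffun J : {set 'I_n} => \sum_t m t * (`[< cell (span_cell t) = cell W >]%:R * span_lin t J)].

Lemma ae_cell_span W : W \in G -> {ae mu, forall x, cell W x -> forall t,
  \1_(ocell (span_cell t)) x = `[< cell (span_cell t) = cell W >]%:R :> R}.
Proof.
move=> WG; pose Q j x := (j < size G)%N ->
  cell W x -> \1_(ocell (nth 0 G j)) x = `[< cell (nth 0 G j) = cell W >]%:R :> R.
have : {ae mu, forall x, forall j, Q j x}.
  apply: ae_foralln => j; rewrite /Q; have [jG|_] := ltnP j (size G); last exact: aeW.
  by apply: filterS (ae_indic_ocell sG (mem_nth 0 jG) WG) => x h _.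
by apply: filterS => x h xW t; exact: (h t.1.1).
Qed.

Lemma comb_span_form m W : W \in G ->
  comb (@span_form) m = (fun x => comb_cst m W + koszul x (comb_lin m W)) %[ae mu in cell W].
Proof.
move=> /ae_cell_span; apply: filterS => x h xW; apply/ffunP => J.
rewrite whitneyE !ffunE.
transitivity (\sum_t (m t * (`[< cell (span_cell t) = cell W >]%:R * span_cst t J) +
    \sum_i x ord0 i * (m t * (`[< cell (span_cell t) = cell W >]%:R *
      koszul_coef (span_lin t) J i)))).
  apply: eq_bigr => t _; rewrite ffunE h// whitneyE mulrDr mulrDr; congr (_ + _).
  by rewrite !mulr_sumr; apply: eq_bigr => i _; ring.
rewrite big_split /=; congr (_ + _); rewrite exchange_big; apply: eq_bigr => i _ /=.
rewrite -mulr_sumr; congr (_ * _); rewrite /koszul_coef; case: ifP => _.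
  by rewrite big1// => t _; rewrite !mulr0.
by rewrite ffunE mulr_sumr; apply: eq_bigr => t _; ring.
Qed.

Lemma kcovector_comb_cst m W : kcovector k (comb_cst m W).
Proof.
move=> J Jk; rewrite ffunE big1// => t _.
by rewrite (kcovector_span_cst _ Jk) !mulr0.
Qed.

Lemma kcovector_comb_lin m W : kcovector k.+1 (comb_lin m W).
Proof.
move=> J Jk; rewrite ffunE big1// => t _.
by rewrite (kcovector_span_lin _ Jk) !mulr0.
Qed.

Lemma whitney_comb m W :
  whitney k (fun x => comb_cst m W + koszul x (comb_lin m W)).
Proof.
by exists (comb_cst m W), (comb_lin m W); split => //;
  [exact: kcovector_comb_cst|exact: kcovector_comb_lin].
Qed.

Lemma L2form_comb_span_form m : L2form Om k (comb (@span_form) m).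
Proof.
split; last by apply: comb_sq; exact: span_form_sq.
move=> x J Jk; rewrite ffunE big1// => t _; rewrite ffunE.
by rewrite (kcovectorD (@kcovector_span_cst t)
  (kcovector_koszul _ (@kcovector_span_lin t))) ?mulr0.
Qed.

Lemma L2form_comb_span_dform m : L2form Om k.+1 (comb (@span_dform) m).
Proof.
split; last by apply: comb_sq; exact: span_dform_sq.
move=> x J Jk; rewrite ffunE big1// => t _; rewrite ffunE.
by rewrite (kcovector_span_lin _ Jk) !mulr0.
Qed.

Lemma piecewise_comb m : piecewise Om G k (whitney (n := n) k) (comb (@span_form) m).
Proof.
split; first exact: L2form_comb_span_form.
move=> W WG; exists (fun x => comb_cst m W + koszul x (comb_lin m W)).
  exact: whitney_comb.
exact: comb_span_form.
Qed.

Lemma dh_comb m : dh Om G k (comb (@span_form) m) (comb (@span_dform) m).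
Proof.
split; first exact: L2form_comb_span_dform.
move=> W WG; exists (fun x => comb_cst m W + koszul x (comb_lin m W)).
split; [exact: whitney_comb|exact: comb_span_form|].
apply: filterS (ae_cell_span WG) => x h xW.
rewrite (extd_whitney _ _ (@kcovector_comb_lin m W)).
apply/ffunP => J; rewrite !ffunE mulr_sumr; apply: eq_bigr => t _.
by rewrite ffunE h//; ring.
Qed.

(** The Whitney form that represents [w] on a cell is affine, hence determined by its values almost
    everywhere there; its derivative does not depend on choices. *)
Lemma dh_unique w u1 u2 : dh Om G k w u1 -> dh Om G k w u2 ->
  {ae mu, forall x, Om x -> u1 x = u2 x}.
Proof.
move=> [_ h1] [_ h2]; apply: (ae_subdivision sG) => V VG.
have aV : affinely_independent V by case: sG => aG _ _; exact: aG.
have [p1 [wp1 e1 d1]] := h1 V VG; have [p2 [wp2 e2 d2]] := h2 V VG.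
have p12 : p1 = p2.
  by apply: (whitney_ae_eq aV wp1 wp2); apply: filterS2 e1 e2 => x h h' xV; rewrite -h// h'.
by apply: filterS2 d1 d2 => x h h' xV; rewrite h// h'// p12.
Qed.

Lemma dh0_cst w V : dh Om G k w (fun=> 0) -> V \in G ->
  exists2 a, kcovector k a & w = (fun=> a) %[ae mu in cell V].
Proof.
move=> [_ /(_ V)] h /[dup] VG /h[p [[a [b [ka kb ->]]] wp dp]].
have aV : affinely_independent V by case: sG => aG _ _; exact: aG.
have [x _] := ae_cell_inhab aV dp; rewrite (extd_whitney _ _ kb) => /ffunP b0.
have {}b0 : b = 0.
  apply/ffunP => J; have := b0 J; rewrite !ffunE => /esym/eqP.
  by rewrite mulf_eq0 pnatr_eq0 => /eqP.
exists a => //; apply: filterS wp => y h' yV; rewrite h'// b0 koszul0 addr0//.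
Qed.

End spanning_forms.
End cellwise_forms.

(** * Piecewise constancy of harmonic forms and the two inclusions *)

Section harmonic_forms.
Context {R : realType} {n : nat}.
Local Notation mu := (lebesgue_rV R n).
Variables (Om : set 'rV[R]_n) (G : seq 'M[R]_(n.+1, n)).
Hypotheses (pOm : polyhedral_domain Om) (sG : simplicial_subdivision Om G).
Implicit Types (w u : form R n) (a b : covector R n) (I J : {set 'I_n}).

Let oOm : open Om. Proof. by case: pOm. Qed.
Let fOm : (mu Om < +oo)%E := domain_measure_lty pOm.
Let aG V : V \in G -> affinely_independent V. Proof. by case: sG => + _ _; exact. Qed.

Lemma ae_ocell V (Q : set 'rV[R]_n) : V \in G ->
  {ae mu, forall x, ocell V x -> Q x} -> {ae mu, forall x, cell V x -> Q x}.
Proof.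
by move=> VG h; apply: filterS2 (ae_cell_ocell (aG VG)) h => x xV Qx /xV.
Qed.

Lemma ae_domain_cell V (Q : set 'rV[R]_n) : V \in G ->
  {ae mu, forall x, Om x -> Q x} -> {ae mu, forall x, cell V x -> Q x}.
Proof.
move=> VG h; apply: ae_ocell => //; apply: filterS h => x h /(ocell_sub pOm sG VG).
exact: h.
Qed.

Lemma piecewise_ae k P w w' : piecewise Om G k P w -> L2form Om k w' ->
  {ae mu, forall x, Om x -> w x = w' x} -> piecewise Om G k P w'.
Proof.
move=> [_ wP] Lw' ww'; split => // V VG; have [p Pp wp] := wP V VG; exists p => //.
by apply: filterS2 (ae_domain_cell VG ww') wp => x h h' xV; rewrite -h// h'.
Qed.

Lemma piecewise_lin k (P : set (form R n)) c w u :
  (forall p q, P p -> P q -> P (lin_form c p q)) ->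
  piecewise Om G k P w -> piecewise Om G k P u -> piecewise Om G k P (lin_form c w u).
Proof.
move=> PD [Lw hw] [Lu hu]; split => [|V VG]; first exact: L2form_lin.
have [p Pp wp] := hw V VG; have [q Pq uq] := hu V VG.
exists (lin_form c p q); first exact: PD.
by apply: filterS2 wp uq => x h h' xV; rewrite /lin_form h// h'.
Qed.

Lemma whitney_lin k c (p q : form R n) : whitney k p -> whitney k q ->
  whitney k (lin_form c p q).
Proof.
move=> [a [b [ka kb ->]]] [a' [b' [ka' kb' ->]]].
exists [ffun I : {set 'I_n} => c * a I + a' I], [ffun I : {set 'I_n} => c * b I + b' I].
split.
- by move=> J Jk; rewrite ffunE ka// ka'// mulr0 addr0.
- by move=> J Jk; rewrite ffunE kb// kb'// mulr0 addr0.
apply/funext => x; apply/ffunP => J; rewrite whitneyE /lin_form [LHS]ffunE !whitneyE ffunE.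
rewrite mulrDr addrACA mulr_sumr -big_split /=; congr (_ + _); apply: eq_bigr => i _.
by rewrite /koszul_coef; case: ifP => _; rewrite ?ffunE; ring.
Qed.

Lemma whitney_star_lin_form k c (p q : form R n) :
  whitney_star k p -> whitney_star k q -> whitney_star k (lin_form c p q).
Proof.
move=> [v wv ->] [z wz ->]; exists (lin_form c v z); first exact: whitney_lin.
by apply/funext => x; apply/ffunP => J; rewrite !ffunE; ring.
Qed.

Lemma whitney_star0 k : whitney_star (R := R) (n := n) k (fun=> 0).
Proof.
exists (fun=> 0); last by apply/funext => x; rewrite hodge0.
by apply: whitney_cst => J _; rewrite ffunE.
Qed.

Lemma codiff_star_cell k w u V : (k < n)%N -> codiff Om k.+1 w u -> V \in G ->
  piecewise Om G k.+1 (whitney_star (n := n) k.+1) w ->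
  exists a b, [/\ kcovector (n - k.+1) a, kcovector (n - k.+1).+1 b,
   w = (fun x => hodge (a + koszul x b)) %[ae mu in cell V] &
   forall I, #|I| = k -> {ae mu, forall x, ocell V x -> u x I = whitney_star_codiff b I}].
Proof.
move=> kn wu VG [_ /(_ V VG)[p [v [a [b [ka kb ->]]] ->] wp]].
exists a, b; split => // I Ik.
apply: (codiff_cell oOm _ _ fOm wu _ Ik (a := a) (U := ocell V)).
- exact: open_ocell.
- exact: (ocell_sub pOm sG VG).
- by apply: filterS wp => x h /(ocell_cell (aG VG)); exact: h.
Qed.

Lemma codiff_star_cst k w u V : (k < n)%N -> codiff Om k.+1 w u -> V \in G ->
  piecewise Om G k.+1 (whitney_star (n := n) k.+1) w ->
  (forall I, #|I| = k -> {ae mu, forall x, ocell V x -> u x I = 0}) ->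
  exists2 a, kcovector k.+1 a & w = (fun=> a) %[ae mu in cell V].
Proof.
move=> kn wu VG pw u0; have [a [b [ka kb wab hu]]] := codiff_star_cell kn wu VG pw.
have b0 : b = 0.
  apply: (whitney_star_codiff_eq0 kb) => I In.
  have Ik : #|I| = k by lia.
  (* The equation does not involve [x]; as the cell is not null, it holds outright. *)
  have h : {ae mu, forall x, cell V x -> whitney_star_codiff b I = 0}.
    by apply: ae_ocell => //; apply: filterS2 (hu I Ik) (u0 I Ik) => x h h' xV;
      rewrite -h// h'.
  by have [] := ae_cell_inhab (aG VG) h.
exists (hodge a); first exact: kcovector_hodge.
by apply: filterS wab => x h xV; rewrite h// b0 koszul0 addr0.
Qed.

Section core.
Variables (k : nat) (D0 D1 : set (form R n)).
Hypothesis kn : (k < n)%N.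
Hypothesis D0_star : D0 `<=` piecewise Om G k.+1 (whitney_star (n := n) k.+1).
Hypothesis D0_0 : D0 (fun=> 0).
Hypothesis D0_lin : forall c w u, D0 w -> D0 u -> D0 (lin_form c w u).
Hypothesis D0_ae : forall w w', D0 w -> L2form Om k.+1 w' ->
  {ae mu, forall x, Om x -> w x = w' x} -> D0 w'.

Lemma harmonic_star_sub_nc :
  ominus Om (null_space (codiff Om k.+1) D0) (range_space (codiff Om k.+2) D1) `<=`
  ominus Om (null_space (dh Om G k.+1) (nonconforming Om G k.+1 D1))
            (range_space (dh Om G k) (nonconforming Om G k D0)).
Proof.
move=> w [[Dw w0] wperp]; have [Lw _ _] := w0.
have cst V : V \in G -> exists2 a, kcovector k.+1 a & w = (fun=> a) %[ae mu in cell V].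
  move=> VG; apply: (codiff_star_cst kn w0 VG (D0_star Dw)) => I _.
  by apply: aeW => x _; rewrite ffunE.
have dw0 : dh Om G k.+1 w (fun=> 0).
  split; first exact: L2form0.
  move=> V VG; have [a ka wa] := cst V VG; exists (fun=> a).
  by rewrite extd_cst; split => //; [exact: whitney_cst|exact: aeW].
split; [split => //; split|].
- split => // V VG; have [a ka wa] := cst V VG; exists (fun=> a) => //.
  exact: whitney_cst.
- move=> u u' w' D1u uu' ww'.
  rewrite wperp; last by exists u.
  have [[_ qw'] _] := ww'; have [[_ qu] _ _] := uu'.
  rewrite (dotL2_ae oOm _ _ _ (dh_unique sG ww' dw0))//.
    (* [w'] is any cellwise derivative of [w]; by uniqueness it may be replaced by the zero form. *)
    by rewrite dotL2_0l// subrr.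
  by have [] := L2form0 oOm fOm k.+2.
- move=> v [z [_ ncz] dz].
  (* [w] itself, with codifferential [0], is the test form in the condition satisfied by [v]. *)
  have := ncz _ _ _ Dw w0 dz; rewrite dotL2_0r// sub0r => /eqP.
  by rewrite oppr_eq0 dotL2C => /eqP.
Qed.

Lemma nc_sub_harmonic_star :
  ominus Om (null_space (dh Om G k.+1) (nonconforming Om G k.+1 D1))
            (range_space (dh Om G k) (nonconforming Om G k D0)) `<=`
  ominus Om (null_space (codiff Om k.+1) D0) (range_space (codiff Om k.+2) D1).
Proof.
move=> w [[[[Lw _] ncw] dw0] wperp]; have [kw qw] := Lw.
have cst V : V \in G -> exists2 a, kcovector k.+1 a & w = (fun=> a) %[ae mu in cell V].
  by move=> VG; apply: dh0_cst dw0 VG.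
have qF := span_form_sq k pOm sG; have qdF := span_dform_sq (G := G) k pOm.
(* The functionals attached to [D0], recorded by their values on the spanning family. The functional
   to be recognised is the one that [w] with codifferential [0] would give. *)
pose C : set (span_index G -> R) := [set c | exists eta u', [/\ D0 eta, codiff Om k.+1 eta u' &
  forall t, c t = dotL2 Om (span_form k t) u' - dotL2 Om (span_dform k t) eta]].
have [eta [u' [Deta etau' etaE]]] : C (fun t => - dotL2 Om (span_dform k t) w).
  apply: double_annihilator.
  - exists (fun=> 0), (fun=> 0); split => //; first exact: codiff0.
    by move=> t; rewrite !dotL2_0r// subrr.
  - move=> c f g [e1 [u1 [De1 eu1 fE]]] [e2 [u2 [De2 eu2 gE]]].
    exists (lin_form c e1 e2), (lin_form c u1 u2); split.
    + exact: D0_lin.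
    + exact: codiff_lin.
    + have [[_ qe1] [_ qu1] _] := eu1; have [[_ qe2] [_ qu2] _] := eu2.
      by move=> t; rewrite !dotL2_linr// fE gE; ring.
  - move=> m hm.
    (* A coefficient vector annihilated by [C] is exactly one whose combination satisfies the
       nonconforming condition, so the orthogonality of [w] applies to its derivative. *)
    have ncm : nonconforming Om G k D0 (comb (span_form k) m).
      split; first exact: piecewise_comb.
      move=> e u v De eu dv; have [[_ qe] [_ qu] _] := eu; have [[_ qv] _] := dv.
      have dm := dh_comb k pOm sG m.
      have qdm := comb_sq pOm m qdF.
      rewrite (dotL2_ae oOm qv qdm qe (dh_unique sG dv dm)) !(dotL2_comb pOm)//.
      rewrite -sumrB -[RHS](hm (fun t => dotL2 Om (span_form k t) u - dotL2 Om (span_dform k t) e)).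
        by apply: eq_bigr => t _; rewrite mulrBr.
      by exists e, u.
    have := wperp (comb (span_dform k) m); rewrite dotL2C (dotL2_comb pOm)// => h.
    under eq_bigr do rewrite mulrN; rewrite sumrN h ?oppr0//.
    by exists (comb (span_form k) m) => //; exact: dh_comb.
have [[keta qeta] [ku' qu'] _] := etau'.
have peta := D0_star Deta.
have indexV V : V \in G -> exists i : 'I_(size G), nth 0 G i = V.
  move=> VG; have iG : (index V G < size G)%N by rewrite index_mem.
  by exists (Ordinal iG); rewrite /= nth_index.
have int_u' V I : V \in G -> #|I| = k -> \int[mu]_(x in ocell V) u' x I = 0.
  move=> VG Ik; have [i iV] := indexV V VG.
  (* [dx^I] on one cell has zero derivative: both terms with [span_dform] drop out and the integral
     of [u'] is left. *)
  have := etaE (i, I, false).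
  have lin0 : span_lin k ((i, I, false) : span_index G) = 0 by [].
  have cstI : span_cst k ((i, I, false) : span_index G) = dx I.
    by rewrite /span_cst /= Ik eqxx.
  have dF0 : span_dform k ((i, I, false) : span_index G) = (fun=> 0).
    apply/funext => x; apply/ffunP => J; rewrite [LHS]ffunE lin0 [RHS]ffunE.
    by rewrite [X in _ * (_ * X)]ffunE !mulr0.
  have FE : span_form k ((i, I, false) : span_index G) =
      (fun x => [ffun J : {set 'I_n} => \1_(ocell V) x * dx I J]).
    apply/funext => x; apply/ffunP => J.
    by rewrite ffunE lin0 koszul0 addr0 cstI [RHS]ffunE /span_cell /= iV.
  rewrite dF0 FE !dotL2_0l// subr0 oppr0 (dotL2_indic_cst pOm sG)// (bigD1 I)//= ffunE eqxx mul1r.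
  by rewrite big1 ?addr0// => J /negbTE JI; rewrite ffunE JI mul0r.
have mu_pos V : V \in G -> fine (mu (ocell V)) != 0.
  move=> VG; rewrite gt_eqF// fine_gt0// ocell_measure_gt0 ?ocell_measure_lty//; exact: aG.
have mV (V : 'M[R]_(n.+1, n)) : measurable (ocell V) by exact: (open_rV_measurable (@open_ocell _ _ V)).
have cst_int V (f : 'rV[R]_n -> R) (r : R) : V \in G -> measurable_fun (ocell V) f ->
    {ae mu, forall x, ocell V x -> f x = r} ->
    \int[mu]_(x in ocell V) f x = r * fine (mu (ocell V)).
  move=> VG mf fr; rewrite -[RHS](Rintegral_cst _ (mV V)); congr fine; apply: ae_eq_integral => //.
    exact/measurable_EFinP.
  by apply: filterS fr => x h xV; rewrite h.
have mOV V f : V \in G -> measurable_fun Om f -> measurable_fun (ocell V) f.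
  move=> VG; apply: measurable_funS; first exact: open_rV_measurable.
  exact: (ocell_sub pOm sG VG).
have u'0 V I : V \in G -> #|I| = k -> {ae mu, forall x, ocell V x -> u' x I = 0}.
  (* On the cell [u'] has a constant component, whose integral was just shown to vanish. *)
  move=> VG Ik; have [a [b [_ _ _ hu]]] := codiff_star_cell kn etau' VG peta.
  have := int_u' V I VG Ik; rewrite (cst_int V _ _ VG _ (hu I Ik)); last first.
    by apply: mOV => //; have [] := qu' I.
  move/eqP; rewrite mulf_eq0 (negbTE (mu_pos _ VG)) orbF => /eqP b0.
  by rewrite -b0; exact: hu.
(* Index sets are numbered by [nat] to unite their null sets; those of the wrong cardinality give
   [0] because [u'] is a [k]-form. *)
have u'0Om : {ae mu, forall x, Om x -> u' x = 0}.
  apply: (ae_subdivision sG) => V VG; apply: ae_ocell => //.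
  have : {ae mu, forall x, forall j : nat, ocell V x ->
      u' x (nth finset.set0 (enum {set 'I_n}) j) = 0}.
    apply: ae_foralln => j; set I := nth _ _ _.
    have [Ik|Ik] := eqVneq #|I| k; first exact: u'0.
    by apply: aeW => x _; exact: ku'.
  apply: filterS => x h xV; apply/ffunP => I; rewrite [RHS]ffunE.
  by have := h (index I (enum {set 'I_n})) xV; rewrite nth_index// mem_enum.
have etaw : {ae mu, forall x, Om x -> eta x = w x}.
  apply: (ae_subdivision sG) => V VG; have [i iV] := indexV V VG.
  have [a ka wa] := cst V VG.
  (* The vanishing of [u'] is what makes [eta] constant on the cell, so that one integral determines
     each component. *)
  have [c kc etac] := codiff_star_cst kn etau' VG peta (fun I => u'0 V I VG).
  have ocst f (e : covector R n) : f = (fun=> e) %[ae mu in cell V] ->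
      forall J, {ae mu, forall x, ocell V x -> f x J = e J}.
    by move=> fe J; apply: filterS fe => x h /(ocell_cell (aG VG))/h ->.
  suff ca : c = a by apply: filterS2 wa etac => x h h' xV; rewrite h// h'// ca.
  apply/ffunP => J; have [Jk|Jk] := eqVneq #|J| k.+1; last by rewrite ka// kc.
  (* The derivative of [koszul x dx^J] is [k.+1] times [dx^J]: since [u'] vanishes, the integrals of
     [eta] and [w] over the cell agree up to this common nonzero factor. *)
  have := etaE (i, J, true).
  have linJ : span_lin k ((i, J, true) : span_index G) = dx J.
    by rewrite /span_lin /= Jk eqxx.
  have dFE : span_dform k ((i, J, true) : span_index G) =
      (fun x => [ffun I : {set 'I_n} => \1_(ocell V) x *
        [ffun I : {set 'I_n} => k.+1%:R * dx J I] I]).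
    apply/funext => x; apply/ffunP => I.
    by rewrite [LHS]ffunE [RHS]ffunE linJ [X in _ = _ * X]ffunE /span_cell /= iV.
  have sumE (f : {set 'I_n} -> R) :
      \sum_I [ffun I : {set 'I_n} => k.+1%:R * dx J I] I * f I = k.+1%:R * f J.
    rewrite (bigD1 J)//= !ffunE eqxx mulr1 big1 ?addr0// => I /negbTE IJ.
    by rewrite !ffunE IJ mulr0 mul0r.
  rewrite dFE !(dotL2_indic_cst pOm sG)// !sumE.
  rewrite (dotL2_aer oOm qu' _ _ u'0Om)//; last by have [] := L2form0 oOm fOm k.
  rewrite dotL2_0r// sub0r.
  have meta : measurable_fun (ocell V) (fun x => eta x J).
    by apply: mOV => //; have [] := qeta J.
  have mw : measurable_fun (ocell V) (fun x => w x J).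
    by apply: mOV => //; have [] := qw J.
  rewrite (cst_int V _ _ VG meta (ocst _ _ etac J)) (cst_int V _ _ VG mw (ocst _ _ wa J)).
  have k0 : k.+1%:R != 0 :> R by rewrite pnatr_eq0.
  by move=> /oppr_inj; rewrite !mulrA => /(mulIf (mu_pos _ VG))/(mulfI k0).
split; [split|].
- exact: D0_ae etaw.
- by apply: (codiff_ae oOm fOm Lw _ etaw u'0Om etau'); exact: L2form0.
- move=> v [z D1z zv]; have := ncw _ _ _ D1z zv dw0.
  by rewrite dotL2_0l// subr0.
Qed.

End core.
Lemma Hstar_ae k w w' : Hstar Om k w -> L2form Om k w' ->
  {ae mu, forall x, Om x -> w x = w' x} -> Hstar Om k w'.
Proof.
move=> [u wu] Lw' ww'; exists u; have [_ Lu _] := wu.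
by apply: (codiff_ae oOm fOm Lw' Lu ww' _ wu); exact: aeW.
Qed.

(** The same approximating test forms serve for [w'], as the norms ignore null sets. *)
Lemma Hstar0_ae k w w' : Hstar0 Om k w -> L2form Om k w' ->
  {ae mu, forall x, Om x -> w x = w' x} -> Hstar0 Om k w'.
Proof.
move=> [u wu hw] Lw' ww'; exists u => [|e /hw[v [z [tv vz we]]]].
  by have [_ Lu _] := wu; apply: (codiff_ae oOm fOm Lw' Lu ww' _ wu); exact: aeW.
have [[_ qw] _ _] := wu; have [_ qw'] := Lw'; have [[_ qv] _ _] := vz.
have ww'v : {ae mu, forall x, Om x -> w x - v x = w' x - v x}.
  by apply: filterS ww' => x h Ox; rewrite h.
have q := sq_subr oOm qw qv; have q' := sq_subr oOm qw' qv.
exists v, z; split; [exact: tv|exact: vz|]; move: we; rewrite !normL2_sqr.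
by rewrite (dotL2_ae oOm q q' q ww'v) (dotL2_aer oOm q q' q' ww'v).
Qed.

Lemma Hstar0_0 k : Hstar0 Om k (fun=> 0).
Proof.
exists (fun=> 0) => [|e e0]; first exact: codiff0.
exists (fun=> 0), (fun=> 0); split; [exact: test_form0|exact: codiff0|].
rewrite (_ : (fun x => _ - _) = (fun=> 0)); last by apply/funext => x; rewrite subrr.
by rewrite !normL2_sqr !dotL2_0l// addr0 sqrtr0.
Qed.

Lemma piecewise_whitney_star0 k : piecewise Om G k (whitney_star (n := n) k) (fun=> 0).
Proof.
split; first exact: L2form0.
by move=> V VG; exists (fun=> 0); [exact: whitney_star0|exact: aeW].
Qed.

End harmonic_forms.

Theorem theorem3p13 (R : realType) (n : nat) (Om : set 'rV[R]_n)
    (G : seq 'M[R]_(n.+1, n)) (k : nat) :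
  (1 <= n)%N -> polyhedral_domain Om -> simplicial_subdivision Om G ->
  (1 <= k <= n - 1)%N ->
  ominus Om (null_space (dh Om G k) (Wnc Om G k))
            (range_space (dh Om G k.-1) (Wnc Om G k.-1))
  = ominus Om (null_space (codiff Om k) (Wstar0 Om G k))
              (range_space (codiff Om k.+1) (Wstar0 Om G k.+1))
  /\
  ominus Om (null_space (dh Om G k) (Wnc0 Om G k))
            (range_space (dh Om G k.-1) (Wnc0 Om G k.-1))
  = ominus Om (null_space (codiff Om k) (Wstar Om G k))
              (range_space (codiff Om k.+1) (Wstar Om G k.+1)).
Proof.
move=> _ pOm sG /andP[k0 kn]; case: k k0 kn => // k _ kn.
have {}kn : (k < n)%N by lia.
have oOm : open Om by case: pOm.
have fOm := domain_measure_lty pOm.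
have star0_sub : Wstar0 Om G k.+1 `<=` piecewise Om G k.+1 (whitney_star (n := n) k.+1).
  by move=> w [].
have star0_0 : Wstar0 Om G k.+1 (fun=> 0).
  by split; [exact: piecewise_whitney_star0|exact: Hstar0_0].
have star0_lin c w u : Wstar0 Om G k.+1 w -> Wstar0 Om G k.+1 u ->
    Wstar0 Om G k.+1 (lin_form c w u).
  move=> [pw Hw] [pu Hu]; split; last exact: Hstar0_lin.
  by apply: piecewise_lin => // p q; exact: whitney_star_lin_form.
have star0_ae w w' : Wstar0 Om G k.+1 w -> L2form Om k.+1 w' ->
    {ae lebesgue_rV R n, forall x, Om x -> w x = w' x} -> Wstar0 Om G k.+1 w'.
  by move=> [pw Hw] Lw' ww'; split; [exact: piecewise_ae ww'|exact: Hstar0_ae ww'].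
have star_sub : Wstar Om G k.+1 `<=` piecewise Om G k.+1 (whitney_star (n := n) k.+1).
  by move=> w [].
have star_0 : Wstar Om G k.+1 (fun=> 0).
  by split; [exact: piecewise_whitney_star0|exists (fun=> 0); exact: codiff0].
have star_lin c w u : Wstar Om G k.+1 w -> Wstar Om G k.+1 u ->
    Wstar Om G k.+1 (lin_form c w u).
  move=> [pw Hw] [pu Hu]; split; last exact: Hstar_lin.
  by apply: piecewise_lin => // p q; exact: whitney_star_lin_form.
have star_ae w w' : Wstar Om G k.+1 w -> L2form Om k.+1 w' ->
    {ae lebesgue_rV R n, forall x, Om x -> w x = w' x} -> Wstar Om G k.+1 w'.
  by move=> [pw Hw] Lw' ww'; split; [exact: piecewise_ae ww'|exact: Hstar_ae ww'].
(* The pair [D0], [D1] is [Wstar0] in degrees [k.+1] and [k.+2] for the first equality, and [Wstar]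
   in these degrees for the second. *)
split; apply/seteqP; split.
- exact: nc_sub_harmonic_star.
- exact: harmonic_star_sub_nc.
- exact: nc_sub_harmonic_star.
- exact: harmonic_star_sub_nc.
Qed.
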